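(* Let $n\ge1$ and let $A_0$ and $A_k,B_k$ ($k\ge1$) be smooth $\mathbb{R}_{0,m}$-valued functions depending only on $\underline{y}$, such that the series below and its termwise derivatives converge. Suppose $\Delta^nA_k=0$ for all $k\ge0$ and, for $k\ge1$, $$B_k=\sum_{j=1}^{\min(n,\lfloor (k+1)/2\rfloor)}\frac{c_j}{(2j-1)!\binom{k}{k-2j+1}}\,\partial_{\underline{y}}^{2j-1}A_{k-2j+1},$$ where $c_1=-\frac12$ and $c_j=-\frac{1}{2^j}\sum_{l=1}^{\lfloor j/2\rfloor}\sum_{i=1}^{l}\binom{j+1}{2l+1}\binom{l}{i}c_{j-i}$ for $j\ge2$. Then $$F(X)=A_0(\underline{y})+\sum_{k=1}^\infty\big(z^kA_k(\underline{y})+\overline{z}^kB_k(\underline{y})\big)$$ is left $n$-monogenic, i.e. $\partial_X^nF=0$.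
   Context: Let $m\ge 2$ and let $\mathbb{R}_{0,m}$ be the real Clifford algebra generated by $e_1,\dots,e_m$ with $e_i^2=-1$ and $e_ie_j=-e_je_i$ for $i\neq j$; all products are Clifford products. Identify $(x_0,\dots,x_m)\in\mathbb{R}^{m+1}$ with $X=x_0+\sum_{j=1}^m x_je_j$, and write $z=x_0+x_1e_1$, $\overline{z}=x_0-x_1e_1$, $\underline{y}=\sum_{j=2}^m x_je_j$. Operators: $\partial_X f=\partial_{x_0}f+\sum_{j=1}^m e_j\partial_{x_j}f$, $\partial_{\underline{y}}f=\sum_{j=2}^m e_j\partial_{x_j}f$; powers denote iterated left application. $\Delta=\sum_{j=2}^m\partial_{x_j}^2=-\partial_{\underline{y}}^2$. *)

(* Defs.v *)
From HB Require Import structures.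
From mathcomp Require Import all_boot all_order all_algebra.
From mathcomp Require Import all_classical all_reals all_analysis.
Set Implicit Arguments. Unset Strict Implicit. Unset Printing Implicit Defensive.
Import Order.TTheory GRing.Theory Num.Theory.
Import numFieldNormedType.Exports.
Local Open Scope ring_scope.

(* ---------- The real Clifford algebra R_{0,m} ----------
   An element is given by its coordinates on the basis blades e_A,
   A a subset of {1..m}; the generator e_i (1 <= i <= m) is encoded by the
   ordinal i-1 : 'I_m.  e_A = e_{a1} ... e_{ak} with a1 < ... < ak. *)
Definition cl (R : Type) (m : nat) := {set 'I_m} -> R.

Section Clifford.
Variables (R : realType) (m : nat).

(* e_A e_B = clsign A B e_{A Δ B}: one sign per inversion (b in B, a in A, b < a)
   and one sign per common generator (e_i^2 = -1). *)
Definition inversions (A B : {set 'I_m}) : {set 'I_m * 'I_m} :=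
  finset (fun p : 'I_m * 'I_m => (p.1 \in A) && (p.2 \in B) && (p.2 < p.1)%N).

Definition clsign (A B : {set 'I_m}) : R :=
  (-1) ^+ (#|inversions A B| + #|A :&: B|).

Definition symdiff (A B : {set 'I_m}) : {set 'I_m} := (A :\: B) :|: (B :\: A).

Definition cl_mul (a b : cl R m) : cl R m :=
  fun C => \sum_(A : {set 'I_m}) a A * b (symdiff A C) * clsign A (symdiff A C).

Definition cl_add (a b : cl R m) : cl R m := fun C => a C + b C.
Definition cl_smul (r : R) (a : cl R m) : cl R m := fun C => r * a C.
Definition cl_scal (r : R) : cl R m := fun C => if C == finset.set0 then r else 0.
Definition cl_one : cl R m := cl_scal 1.
Definition cl_exp (a : cl R m) (k : nat) : cl R m := iter k (cl_mul a) cl_one.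
(* the generator e_i, 1-based index i (meaningful for 1 <= i <= m) *)
Definition ebas (i : nat) : cl R m :=
  fun C => if C == finset (fun j : 'I_m => (j : nat) == i.-1) then 1 else 0.

Definition xc (X : 'rV[R]_(m.+1)) (j : nat) : R := X ord0 (inord j).
Definition dvec (j : 'I_m.+1) : 'rV[R]_(m.+1) := delta_mx ord0 j.

Definition pd (j : 'I_m.+1) (f : 'rV[R]_(m.+1) -> cl R m) : 'rV[R]_(m.+1) -> cl R m :=
  fun X C => 'D_(dvec j) (fun Y => f Y C) X.

Definition iterpd (ds : seq 'I_m.+1) (f : 'rV[R]_(m.+1) -> cl R m) :=
  foldr pd f ds.

Definition dirac_op (f : 'rV[R]_(m.+1) -> cl R m) : 'rV[R]_(m.+1) -> cl R m :=
  fun X C => pd (inord 0) f X C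
    + \sum_(j < m) cl_mul (ebas j.+1) (pd (inord j.+1) f X) C.

Definition dy (f : 'rV[R]_(m.+1) -> cl R m) : 'rV[R]_(m.+1) -> cl R m :=
  fun X C => \sum_(j < m | (1 <= j)%N) cl_mul (ebas j.+1) (pd (inord j.+1) f X) C.

Definition lapy (f : 'rV[R]_(m.+1) -> cl R m) : 'rV[R]_(m.+1) -> cl R m :=
  fun X C => \sum_(j < m | (1 <= j)%N) pd (inord j.+1) (pd (inord j.+1) f) X C.

Definition smooth (f : 'rV[R]_(m.+1) -> cl R m) : Prop :=
  forall (ds : seq 'I_m.+1) (C : {set 'I_m}),
    (forall (j : 'I_m.+1) X, derivable (fun Y => iterpd ds f Y C) X (dvec j)) /\
    continuous (fun Y => iterpd ds f Y C).

Definition depends_only_on_y (f : 'rV[R]_(m.+1) -> cl R m) : Prop :=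
  forall X Y : 'rV[R]_(m.+1),
    (forall j : 'I_m.+1, (2 <= j)%N -> X ord0 j = Y ord0 j) ->
    forall C, f X C = f Y C.

Definition loc_unif_cvg (S : nat -> 'rV[R]_(m.+1) -> R) : Prop :=
  forall X0 : 'rV[R]_(m.+1), exists2 r : R, 0 < r &
    exists g : 'rV[R]_(m.+1) -> R, forall e : R, 0 < e ->
      exists N : nat, forall (k : nat) (Y : 'rV[R]_(m.+1)),
        (N <= k)%N -> ball X0 r Y -> `|S k Y - g Y| < e.

Definition zc (X : 'rV[R]_(m.+1)) : cl R m :=
  cl_add (cl_scal (xc X 0)) (cl_smul (xc X 1) (ebas 1)).
Definition zbc (X : 'rV[R]_(m.+1)) : cl R m :=
  cl_add (cl_scal (xc X 0)) (cl_smul (- xc X 1) (ebas 1)).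

Definition sterm (Af Bf : nat -> 'rV[R]_(m.+1) -> cl R m) (k : nat)
  : 'rV[R]_(m.+1) -> cl R m :=
  fun X => cl_add (cl_mul (cl_exp (zc X) k) (Af k X))
                  (cl_mul (cl_exp (zbc X) k) (Bf k X)).

Definition psum (Af Bf : nat -> 'rV[R]_(m.+1) -> cl R m) (N : nat)
  : 'rV[R]_(m.+1) -> cl R m :=
  fun X C => Af 0%N X C + \sum_(1 <= k < N.+1) sterm Af Bf k X C.

Definition Fser (Af Bf : nat -> 'rV[R]_(m.+1) -> cl R m) : 'rV[R]_(m.+1) -> cl R m :=
  fun X C => limn (fun N => psum Af Bf N X C).

End Clifford.

(* Main.v *)
(* Put d = d_y. The Dirac operator acts on W_k f = z^k f / k! and
   Wb_k f = zbar^k f / k! by D (W_k f) = Wb_k (d f) and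
   D (Wb_k f) = 2 Wb_(k-1) f + W_k (d f). So, with u standing for d times the index
   raising shift, D is the matrix [[0, u], [u, 2]], and the block of the series
   generated by a single A_k is the column (1, g / u), where g = sum_j c_j v^j and
   v = u^2. The components of D^r on this column are w_r and w_(r+1) / u, where
   w_0 = 1, w_1 = g, w_(r+2) = 2 w_(r+1) + v w_r. One has
   w_(r+1) = v U_(r-1) + g U_r with U_r = sum_l C(r+1, 2l+1) (1 + v)^l, and the
   recurrence for c says that the coefficient of v^j in g U_j vanishes; hence
   v^r divides w_r, and d^(2n) A_k = 0 kills D^n on each block.
   A partial sum of the series cuts the last blocks. The remainder of D^n is a
   combination of terms D^t (W_(k-i) d^p A_k) and D^t (Wb_(k-i) d^p B_k) with i > 0,
   t + i + p = n. These are derivatives of order n of the k-th term of the series,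
   because a z-derivative isolates A_k and a zbar-derivative isolates B_k; so they
   tend to 0. *)

Require Import Defs.
From HB Require Import structures.
From mathcomp Require Import all_boot all_order all_algebra.
From mathcomp Require Import all_classical all_reals all_analysis.
From mathcomp Require Import ring lra zify.
Set Implicit Arguments. Unset Strict Implicit. Unset Printing Implicit Defensive.
Import Order.TTheory GRing.Theory Num.Theory.
Import numFieldNormedType.Exports.
Local Open Scope ring_scope.

(** * Coefficients *)

Section Coefficients.
Variables (R : numFieldType).
Implicit Types (N r l i j : nat).
Local Notation q := (1 + 'X : {poly R}).

Lemma coef_1DXn l i : (q ^+ l)`_i = 'C(l, i)%:R.
Proof.
elim: l i => [|l IHl] i; first by rewrite expr0 coef1 bin0n.
rewrite exprSr mulrDr mulr1 coefD coefMX !IHl.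
by case: i => [|i] /=; rewrite ?addr0 ?bin0 // binS natrD addrC.
Qed.

(* [oddp N r] and [evenp N r] are the odd and even parts of [(1 + s)^r] in
   terms of [s^2 = 1 + X], as soon as [r < 2 N]. *)
Definition oddp N r : {poly R} := \sum_(l < N) 'C(r, l.*2.+1)%:R *: q ^+ l.
Definition evenp N r : {poly R} := \sum_(l < N) 'C(r, l.*2)%:R *: q ^+ l.

Lemma oddpS N r : oddp N r.+1 = oddp N r + evenp N r.
Proof.
rewrite -big_split; apply: eq_bigr => l _ /=.
by rewrite -scalerDl binS natrD.
Qed.

(** Even part of $(1+s)(E+sO) = (E+s^2O) + s(E+O)$. The bound on [r] kills the top term of [oddp],
    whose product with $s^2$ would overflow the truncated even part. *)
Lemma evenpS N r : (r < N.*2.+1)%N -> evenp N.+1 r.+1 = evenp N.+1 r + q * oddp N.+1 r.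
Proof.
move=> rN; rewrite /oddp big_ord_recr /= /evenp !big_ord_recl /=.
rewrite (bin_small rN) scale0r addr0 -addrA !bin0; congr (_ + _).
rewrite mulr_sumr -big_split /=; apply: eq_bigr => l _.
rewrite /bump /= add1n doubleS binS natrD scalerDl exprS !scalerAr.
by congr (_ + _); congr (_ * _).
Qed.

(** Odd part of $(1+s)^{r+2}$, from $(1+s)^2 = 2(1+s) + X$. This is also the recurrence of the
    $w_r$. *)
Lemma oddpSS N r : (r < N.*2.+1)%N ->
  oddp N.+1 r.+2 = oddp N.+1 r.+1 *+ 2 + 'X * oddp N.+1 r.
Proof.
move=> rN; rewrite oddpS evenpS // [in RHS]mulr2n {2}oddpS.
by ring.
Qed.

Lemma oddp0 N : oddp N 0 = 0.
Proof. by apply: big1 => l _; rewrite bin0n scale0r. Qed.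

Lemma oddp1 N : oddp N.+1 1 = 1.
Proof.
rewrite /oddp big_ord_recl big1 ?addr0 ?scale1r //= => l _.
by rewrite bin_small ?scale0r.
Qed.

(** At $X=0$ one has $q=1$, and the recurrence [oddpSS] becomes doubling. *)
Lemma sum_bin_odd N r : (r < N.*2.+2)%N ->
  \sum_(l < N.+1) 'C(r.+1, l.*2.+1)%:R = 2 ^+ r :> R.
Proof.
suff E s : (s < N.*2.+2)%N -> (oddp N.+1 s.+1).[0] = 2 ^+ s.
  move=> /E <-; rewrite horner_sum; apply: eq_bigr => l _.
  by rewrite !hornerE expr1n mulr1.
elim/ltn_ind: s => -[|[|s]] IHs sN; first by rewrite oddp1 hornerE.
  by rewrite oddpSS // oddp0 oddp1 !hornerE expr1 -mulr2n.
rewrite oddpSS; last lia.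
rewrite hornerD hornerMn hornerM hornerX mul0r addr0 IHs //; last lia.
by rewrite [in RHS]exprS mulr_natl.
Qed.

(** The degree of [oddp N j] is at most $(j-1)/2$, which is less than $j-1$ for $j>1$. *)
Lemma coef_oddp_small N j : (1 < j)%N -> (oddp N j)`_j.-1 = 0.
Proof.
move=> j1; rewrite coef_sum; apply: big1 => l _; rewrite coefZ coef_1DXn.
have [?|?] := ltnP j l.*2.+1; first by rewrite bin_small // mul0r.
by rewrite (@bin_small l) ?mulr0 //; lia.
Qed.

(** * The polynomials $w_r$ attached to the coefficients $c_j$ *)

Variables (n : nat) (c : nat -> R).
Hypothesis c1 : c 1%N = - (1 / 2).
Hypothesis cS : forall j, (2 <= j)%N -> c j = - (1 / 2 ^+ j) *
  \sum_(1 <= l < (j./2).+1) \sum_(1 <= i < l.+1)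
     ('C(j.+1, (2 * l).+1)%:R * 'C(l, i)%:R * c (j - i)%N).

(** The polynomial $g$ up to degree [n]. Its constant term is set to 0 explicitly, since the
    recurrence does not determine [c 0]. *)
Definition cpoly : {poly R} := \poly_(j < n.+1) (if j is 0%N then 0 else c j).

(** Carrying the pair $(w_r, w_{r+1})$ makes the second-order recurrence structural. *)
Fixpoint dcoef2 r : {poly R} * {poly R} :=
  if r is r'.+1 then
    let p := dcoef2 r' in (p.2, p.2 *+ 2 + 'X * p.1)
  else (1, cpoly).
(* The coefficient of [d^(2j) A] in the [r]-th power of the Dirac operator
   applied to the block of the series generated by a single [A]. *)
Definition dcoef r := (dcoef2 r).1.

Lemma dcoefSS r : dcoef r.+2 = dcoef r.+1 *+ 2 + 'X * dcoef r.
Proof. by []. Qed.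

(** Both sides satisfy the recurrence of [oddpSS] and agree for $r=0,1$. Here [oddp N.+1 r.+1] is
    $U_r$. *)
Lemma dcoefE N r : (r < N.*2.+1)%N ->
  dcoef r.+1 = 'X * oddp N.+1 r + cpoly * oddp N.+1 r.+1.
Proof.
elim/ltn_ind: r => -[|[|r]] IHr rN.
- by rewrite oddp0 oddp1 mulr0 mulr1 add0r.
- rewrite dcoefSS oddpSS // oddp0 oddp1; rewrite /dcoef /=; ring.
rewrite dcoefSS !IHr //; try lia.
rewrite (@oddpSS _ r.+1) ?(@oddpSS _ r) //; try lia.
ring.
Qed.

(** The recurrence for $c_j$, rearranged: its inner sums over $i\ge1$ are completed by the terms
    $i=0$, whose total is $2^j c_j$ by [sum_bin_odd]. *)
Lemma coef_cpoly_oddp N j : (2 <= j <= n)%N -> (j <= N.*2)%N ->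
  (cpoly * oddp N.+1 j.+1)`_j = 0.
Proof.
move=> /andP[j2 jn] jN.
(* In the surviving terms $i\le l\le j/2$, so $j-i\ge1$ and the constant term of [cpoly] never
   enters. *)
have E l : (l <= j./2)%N -> (cpoly * q ^+ l)`_j = \sum_(i < l.+1) 'C(l, i)%:R * c (j - i)%N.
  move=> lj; rewrite coefMr (big_ord_widen j.+1 (fun i => 'C(l, i)%:R * c (j - i)%N)); last lia.
  rewrite [RHS]big_mkcond /=; apply: eq_bigr => i _.
  rewrite coef_1DXn ltnS; case: leqP => il; last by rewrite bin_small // mulr0.
  rewrite coef_poly ifT; last lia.
  by rewrite mulrC; case E: (j - i)%N => //; lia.
have : 2 ^+ j * c j + \sum_(1 <= l < (j./2).+1) \sum_(1 <= i < l.+1)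
     ('C(j.+1, (2 * l).+1)%:R * 'C(l, i)%:R * c (j - i)%N) = 0.
  have n2 : 2 ^+ j != 0 :> R by rewrite expf_neq0 // pnatr_eq0.
  by rewrite [in X in X + _]cS // mulrA mulrN div1r divff // mulN1r addNr.
move=> H; apply: etrans H; rewrite -(@sum_bin_odd N); last lia.
rewrite mulr_suml /oddp mulr_sumr.
rewrite coef_sum.
under eq_bigr => l _ do rewrite -scalerAr coefZ.
rewrite [X in _ = _ + X](@big_nat_widenl _ _ _ 1 0 _ xpredT) //.
rewrite [X in _ = _ + X](@big_nat_widen _ _ _ 0 _ N.+1 _); last lia.
rewrite big_mkord [X in _ = _ + X]big_mkcond -big_split /=.
apply: eq_bigr => l _.
have [/andP[l0 lj]|] := boolP (0 < l < j./2.+1)%N.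
  rewrite E; last lia.
  rewrite big_ord_recl /= subn0 bin0 mul1r mulrDr; congr (_ + _).
  rewrite big_add1 /= big_mkord mulr_sumr; apply: eq_bigr => i _.
  by rewrite mul2n mulrA.
(* What remains is $l=0$, where only $i=0$ occurs, and $l>j/2$, where the outer binomial is 0. *)
rewrite addr0; case: (posnP l) => [->|l0 lj].
  by rewrite expr0 mulr1 coef_poly ifT //; case: (j) j2.
by rewrite bin_small ?mul0r //; lia.
Qed.

(** Divisibility of $w_r$ by $v^r$, up to degree [n]. The coefficients just below $v^r$ vanish by
    [dcoefE]; the recurrence of the $w_r$ propagates this to all lower ones. *)
Lemma coef_dcoef_small r j : (j < r)%N -> (j <= n)%N -> (dcoef r)`_j = 0.
Proof.
have diag s : (s <= n)%N -> (dcoef s.+1)`_s = 0.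
  move=> sn; rewrite (@dcoefE s); last lia.
  rewrite coefD coefXM; case: s sn => [|[|s]] sn.
  - by rewrite oddp1 mulr1 coef_poly add0r.
  (* The coefficient is $1+2c_1$, which is where the value $c_1=-1/2$ comes from. *)
  - rewrite oddp1 oddpSS // oddp0 oddp1 mulr0 addr0 mulrnAr mulr1 coefMn.
    by rewrite coef1 coef_poly ltnS sn c1 /=; field.
  by rewrite coef_oddp_small // add0r coef_cpoly_oddp //; lia.
elim/ltn_ind: r j => r IHr j jr jn.
move: jr; rewrite leq_eqVlt => /orP[/eqP<-|jr]; first exact: diag.
case: r IHr jr => [|[|r]] IHr jr; try lia.
rewrite dcoefSS coefD coefMn coefXM IHr //.
rewrite mul0rn add0r; case: j jr jn => [|j] jr jn //=.
by apply: IHr; lia.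
Qed.

End Coefficients.

(** * Powers of the Dirac operator on formal series *)

Section FormalDirac.
Variables (R : numFieldType) (E : lmodType R) (d D Dz Dzb : {linear E -> E}).
Variables (W Wb : nat -> {linear E -> E}).
Hypothesis DW : forall k f, D (W k f) = Wb k (d f).
Hypothesis DWb0 : forall f, D (Wb 0%N f) = W 0%N (d f).
Hypothesis DWbS : forall k f, D (Wb k.+1 f) = Wb k f *+ 2 + W k.+1 (d f).
Implicit Types (ab : (nat -> E) * (nat -> E)).

Lemma iter_linearP (L : {linear E -> E}) t : linear (iter t L).
Proof. by elim: t => // t IHt c f g /=; rewrite IHt linearP. Qed.

Lemma iter_linearD (L : {linear E -> E}) t : {morph iter t L : f g / f + g}.
Proof. by move=> f g; rewrite -[f]scale1r iter_linearP !scale1r. Qed.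

Lemma iter_linear0 (L : {linear E -> E}) t : iter t L 0 = 0.
Proof. by elim: t => //= t ->; rewrite linear0. Qed.

Lemma iter_linearZ (L : {linear E -> E}) t c f : iter t L (c *: f) = c *: iter t L f.
Proof. by rewrite -[c *: f]addr0 iter_linearP iter_linear0 addr0. Qed.

Lemma iter_linearB (L : {linear E -> E}) t : {morph iter t L : f g / f - g}.
Proof. by move=> f g; rewrite -scaleN1r iter_linearD iter_linearZ scaleN1r. Qed.

Lemma iter_linear_double (L : {linear E -> E}) t f : iter t L (f *+ 2) = 2 *: iter t L f.
Proof. by rewrite mulr2n iter_linearD scaler_nat mulr2n. Qed.

(* The action of [D] on the coefficients of [\sum_k W k (a k) + Wb k (b k)]. *)
Definition fstep ab := (fun k => d (ab.2 k), fun k => d (ab.1 k) + ab.2 k.+1 *+ 2).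

(** * Closed form of the coefficients after r formal steps *)

Section ClosedForm.
Variables (n : nat) (c : nat -> R) (alpha beta : nat -> E).
Local Notation coef r j := (dcoef n c r)`_j.

(** Entry [k] of $u^p\alpha$. The guard is there because truncated subtraction would return
    $\alpha_0$ for $k<p$. *)
Definition dshift p k := if (p <= k)%N then iter p d (alpha (k - p)%N) else 0.

Lemma dshiftS p k : d (dshift p k) = dshift p.+1 k.+1.
Proof. by rewrite /dshift ltnS subSS; case: ifP => // _; rewrite linear0. Qed.

Hypothesis d2n : forall k, iter n.*2 d (alpha k) = 0.
Hypothesis betaE : forall k, beta k = \sum_(j < n) c j.+1 *: dshift j.*2.+1 k.

Lemma dshift_large p k : (n.*2 <= p)%N -> dshift p k = 0.
Proof.
move=> np; rewrite /dshift; case: ifP => // _.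
by rewrite -(subnK np) iterD d2n iter_linear0.
Qed.

(** This makes $w_{r+1}/u$ a polynomial in $u$. *)
Lemma coef_dcoef0 r : (dcoef n c r.+1)`_0 = 0.
Proof.
elim/ltn_ind: r => -[|r] IHr; first by rewrite coef_poly.
by rewrite dcoefSS coefD coefMn coefXM IHr // mul0rn addr0.
Qed.

(** One [fstep] is the matrix $[[0,u],[u,2]]$ followed by lowering the index by one, whence the
    index [k + r]. The two components are $w_r\alpha$ and $(w_{r+1}/u)\alpha$. *)
Lemma iter_fstepE r k :
  (iter r fstep (alpha, beta)).1 k = \sum_(j < n.+1) coef r j *: dshift j.*2 (k + r) /\
  (iter r fstep (alpha, beta)).2 k = \sum_(j < n) coef r.+1 j.+1 *: dshift j.*2.+1 (k + r).
Proof.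
elim: r k => [|r IHr] k.
  split; last first.
    rewrite /= betaE addn0; apply: eq_bigr => j _.
    by rewrite coef_poly ltnS ltn_ord.
  rewrite big_ord_recl big1 => [|j _]; last by rewrite coef1 scale0r.
  by rewrite coef1 /= scale1r addr0 addn0 /dshift /= subn0.
split.
  rewrite /= (IHr k).2 linear_sum big_ord_recl coef_dcoef0 scale0r add0r.
  by apply: eq_bigr => j _; rewrite linearZ /= dshiftS addnS /bump add1n doubleS.
(* The term $j=n$ of the first component acquires $d^{2n+1}$ and drops out, so both sums have [n]
   terms. *)
rewrite /= (IHr k).1 (IHr k.+1).2 big_ord_recr /= linearD linear_sum linearZ /=.
rewrite dshiftS dshift_large ?scaler0 ?addr0; last by lia.
rewrite -scaler_nat scaler_sumr -big_split /=; apply: eq_bigr => j _.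
rewrite dcoefSS coefD coefMn coefXM /= linearZ /= dshiftS scalerA addSn addnS.
by rewrite scalerDl addrC mulr_natl.
Qed.

End ClosedForm.

(** * Remainders left by cutting off a partial sum *)

Section Boundary.
Variable null : (nat -> E) -> Prop.
Hypothesis null0 : null (fun=> 0).
Hypothesis nullP : forall c u v, null u -> null v -> null (fun k => c *: u k + v k).
Hypothesis null_shift : forall u, null (fun k => u k.+1) <-> null u.
Variable n : nat.

Definition fpsum ab N := \sum_(k < N.+1) (W k (ab.1 k) + Wb k (ab.2 k)).

(** Invariant for the remainders: [r] formal steps have been spent on the coefficients, and the
    [n - r] remaining derivatives are split into [t] powers of [D] and a lag [i] between the index
    of the coefficient and that of [W]. *)
Definition boundary_null r ab := forall t i, (0 < i)%N -> (t + i + r)%N = n ->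
  null (fun k => iter t D (W k (ab.1 (k + i)%N))) /\
  null (fun k => iter t D (Wb k (ab.2 (k + i)%N))).

(** Solving the commutation rules for the new terms gives $W_{k+1}(db) = D(\overline{W}_{k+1}b) -
    2\overline{W}_k b$ and $\overline{W}_k(da) = D(W_k a)$. Each right-hand term raises [t] or [i]
    by one, in exchange for one unit of [r]. *)
Lemma boundary_null_fstep r ab : boundary_null r ab -> boundary_null r.+1 (fstep ab).
Proof.
move=> bn t i i0 tir; split.
  apply/null_shift.
  rewrite (_ : (fun _ => _) = fun k => - 2 *: iter t D (Wb k (ab.2 (k + i.+1)%N)) +
      iter t.+1 D (Wb k.+1 (ab.2 (k.+1 + i)%N))); last first.
    apply/funext => k /=; rewrite addSnnS -/(iter t.+1 D _) iterSr DWbS iter_linearD.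
    by rewrite iter_linear_double addrA -scalerDl addNr scale0r add0r.
  apply: nullP; first by have [] := bn t i.+1 isT; first lia.
  apply/(null_shift (fun k => iter t.+1 D (Wb k (ab.2 (k + i)%N)))).
  by have [] := bn t.+1 i i0; first lia.
rewrite (_ : (fun _ => _) = fun k => 2 *: iter t D (Wb k (ab.2 (k + i.+1)%N)) +
    iter t.+1 D (W k (ab.1 (k + i)%N))); last first.
  apply/funext => k /=; rewrite -/(iter t.+1 D _) iterSr DW linearD iter_linearD addrC.
  by rewrite linearMn iter_linear_double addnS.
apply: nullP; first by have [] := bn t i.+1 isT; first lia.
by have [] := bn t.+1 i i0; first lia.
Qed.

(** The last block of [fstep ab] uses [ab.2 N.+1], which the partial sum up to [N] does not contain;
    the correction removes this contribution. *)
Lemma D_fpsum ab N : D (fpsum ab N) = fpsum (fstep ab) N - Wb N (ab.2 N.+1) *+ 2.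
Proof.
have fS u k : fpsum u k.+1 = fpsum u k + (W k.+1 (u.1 k.+1) + Wb k.+1 (u.2 k.+1)).
  by rewrite /fpsum big_ord_recr.
elim: N => [|N IHN].
  rewrite /fpsum !big_ord1 /= !linearD /= DW DWb0.
  by rewrite -opprD addrA addrK addrC.
rewrite !fS linearD IHN /=.
rewrite !linearD /= DW DWbS !mulr2n -!addrA; congr (_ + _).
rewrite -!opprD (addrA (Wb N.+1 _) (Wb N.+1 _) (- _)) subrr addr0.
by rewrite addrA -opprD (addrA (Wb N _) (Wb N _) (W _ _)) addrCA addKr addrC.
Qed.

(** Each application of [D] leaves one remainder from [D_fpsum], a boundary term with lag $i=1$. *)
Lemma null_iterD_fpsum r s ab : (s + r)%N = n -> boundary_null r ab ->
  null (fun N => iter s D (fpsum ab N) - fpsum (iter s fstep ab) N).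
Proof.
elim: s r ab => [|s IHs] r ab srn bn.
  by under [X in null X]eq_fun => N do rewrite /= subrr.
rewrite (_ : (fun _ => _) = fun N => - 2 *: iter s D (Wb N (ab.2 (N + 1)%N)) +
  (iter s D (fpsum (fstep ab) N) - fpsum (iter s fstep (fstep ab)) N)); last first.
  apply/funext => N; rewrite !iterSr D_fpsum iter_linearB iter_linear_double.
  by rewrite addn1 scaleNr addrA (addrC (- _)).
apply: nullP; first by have [] := bn s 1%N isT; first lia.
by apply: (IHs r.+1); [lia | exact: boundary_null_fstep].
Qed.

Hypothesis DzWS : forall k f, Dz (W k.+1 f) = W k f *+ 2.
Hypothesis DzWb : forall k f, Dz (Wb k f) = 0.
Hypothesis DzbWbS : forall k f, Dzb (Wb k.+1 f) = Wb k f *+ 2.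
Hypothesis DzbW : forall k f, Dzb (W k f) = 0.

(** Applying [Dz] [i] times to the block of index [k + i] turns its first term into $2^i W_k
    a_{k+i}$ and kills the second as soon as $i>0$; [Dzb] does the reverse. So the boundary terms
    are derivatives of whole blocks. *)
Lemma boundary_null0 ab :
  (forall t i, (t + i)%N = n -> 
     null (fun k => iter t D (iter i Dz (W k (ab.1 k) + Wb k (ab.2 k)))) /\
     null (fun k => iter t D (iter i Dzb (W k (ab.1 k) + Wb k (ab.2 k))))) ->
  boundary_null 0 ab.
Proof.
move=> H t i i0; rewrite addn0 => /H[Hz Hzb].
have shift u : null u -> null (fun k => u (k + i)%N).
  elim: {i0 H Hz Hzb} i u => [|i IHi] u; first by under eq_fun => k do rewrite addn0.
  move=> /(null_shift u).2/IHi; congr null; apply/funext => k.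
  by rewrite addnS.
have scale u : null (fun k => 2 ^+ i *: u k) -> null u.
  move=> nu; rewrite (_ : u = fun k => 2 ^- i *: (2 ^+ i *: u k) + 0); first exact: nullP.
  by apply/funext => k; rewrite addr0 scalerA mulVf ?scale1r // expf_neq0 // pnatr_eq0.
split; apply: scale.
  have EW k f : iter i Dz (W (k + i)%N f) = 2 ^+ i *: W k f.
    elim: {i0 H Hz Hzb shift} i => [|i IHi]; first by rewrite addn0 scale1r.
    by rewrite iterSr addnS DzWS iter_linear_double IHi scalerA exprS.
  move/shift: Hz; congr null; apply/funext => k.
  rewrite iter_linearD EW; case: (i) i0 => // j _.
  by rewrite [in X in _ + X]iterSr DzWb iter_linear0 addr0 iter_linearZ.
have EW k f : iter i Dzb (Wb (k + i)%N f) = 2 ^+ i *: Wb k f.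
  elim: {i0 H Hz Hzb shift} i => [|i IHi]; first by rewrite addn0 scale1r.
  by rewrite iterSr addnS DzbWbS iter_linear_double IHi scalerA exprS.
move/shift: Hzb; congr null; apply/funext => k.
rewrite iter_linearD EW; case: (i) i0 => // j _.
by rewrite [in X in X + _]iterSr DzbW iter_linear0 add0r iter_linearZ.
Qed.

(** After [n] formal steps all coefficients are 0, by divisibility of $w_n$ and $w_{n+1}$ and by
    $d^{2n}\alpha_k=0$. Hence $D^n$ of a partial sum consists of remainders only. *)
Lemma null_iterD (c : nat -> R) (alpha beta : nat -> E) :
  c 1%N = - (1 / 2) ->
  (forall j, (2 <= j)%N -> c j = - (1 / 2 ^+ j) *
     \sum_(1 <= l < (j./2).+1) \sum_(1 <= i < l.+1)
        ('C(j.+1, (2 * l).+1)%:R * 'C(l, i)%:R * c (j - i)%N)) ->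
  (forall k, iter n.*2 d (alpha k) = 0) ->
  (forall k, beta k = \sum_(j < n) c j.+1 *: dshift alpha j.*2.+1 k) ->
  (forall t i, (t + i)%N = n ->
     null (fun k => iter t D (iter i Dz (W k (alpha k) + Wb k (beta k)))) /\
     null (fun k => iter t D (iter i Dzb (W k (alpha k) + Wb k (beta k))))) ->
  null (fun N => iter n D (fpsum (alpha, beta) N)).
Proof.
move=> c1 cS d2n betaE base.
have E1 k : (iter n fstep (alpha, beta)).1 k = 0.
  rewrite (iter_fstepE d2n betaE n k).1 big_ord_recr /= (dshift_large d2n) // scaler0 addr0.
  by apply: big1 => j _; rewrite (coef_dcoef_small c1 cS) ?scale0r // ltnW.
have E2 k : (iter n fstep (alpha, beta)).2 k = 0.
  rewrite (iter_fstepE d2n betaE n k).2.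
  by apply: big1 => j _; rewrite (coef_dcoef_small c1 cS) ?scale0r ?ltnS ?ltn_ord.
rewrite (_ : (fun _ => _) = fun N => iter n D (fpsum (alpha, beta) N) -
   fpsum (iter n fstep (alpha, beta)) N).
  by apply: (null_iterD_fpsum (addn0 n)); apply: boundary_null0.
apply/funext => N; rewrite [fpsum (iter _ _ _) N]big1 ?subr0 // => k _.
by rewrite E1 E2 !linear0 addr0.
Qed.

End Boundary.
End FormalDirac.

(** * The Clifford product *)

Section CliffordProduct.
Variables (R : realType) (m : nat).
Implicit Types (A B C : {set 'I_m}) (a b : cl R m) (i j : 'I_m).

Lemma in_symdiff A B i : (i \in symdiff A B) = (i \in A) (+) (i \in B).
Proof. by rewrite !inE; case: (i \in A); case: (i \in B). Qed.

Lemma symdiffA A B C : symdiff A (symdiff B C) = symdiff (symdiff A B) C.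
Proof. by apply/setP => i; rewrite !in_symdiff addbA. Qed.

Lemma symdiffC A B : symdiff A B = symdiff B A.
Proof. by apply/setP => i; rewrite !in_symdiff addbC. Qed.

Lemma symdiffK A B : symdiff A (symdiff A B) = B.
Proof. by apply/setP => i; rewrite !in_symdiff addKb. Qed.

Lemma symdiff0 A : symdiff finset.set0 A = A.
Proof. by apply/setP => i; rewrite !in_symdiff inE. Qed.

(** Sign of moving $e_i$ past $e_j$ into sorted order: an inversion if $j<i$, a square if $j=i$. *)
Definition epair i j : R := if (j <= i)%N then -1 else 1.

(* The sign is a bicharacter of the group of blades under symmetric difference. *)
Lemma clsignE A B : clsign R A B = \prod_(i in A) \prod_(j in B) epair i j.
Proof.
have sgn (T : finType) (P : pred T) : \prod_(i : T) (if P i then -1 else 1) = (-1) ^+ #|P| :> R.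
  by rewrite -big_mkcond /= prodr_const.
rewrite /clsign exprD pair_big_dep /=.
have -> : (-1) ^+ #|inversions A B| = \prod_(p : 'I_m * 'I_m)
    (if [&& p.1 \in A, p.2 \in B & (p.2 < p.1)%N] then -1 else 1) :> R.
  by rewrite sgn; congr (_ ^+ _); apply: eq_card => p; rewrite !inE -andbA.
have -> : (-1) ^+ #|A :&: B| = \prod_(p : 'I_m * 'I_m)
    (if [&& p.1 \in A, p.2 \in B & p.2 == p.1] then -1 else 1) :> R.
  rewrite sgn; congr (_ ^+ _).
  rewrite -(card_imset _ (f := fun i => (i, i))) => [|i j []//].
  apply: eq_card => -[i j]; rewrite [RHS]unfold_in /=; apply/imsetP/idP => [[k]|].
    by case/finset.setIP=> kA kB [-> ->]; rewrite kA kB eqxx.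
  by case/and3P=> iA iB /eqP E; exists i; rewrite ?inE ?iA -?E ?iB // -?E.
rewrite -big_split /= [RHS]big_mkcond /=; apply: eq_bigr => -[i j] _ /=.
rewrite /epair; case: (i \in A) (j \in B) => [] [] /=; rewrite ?mulr1 //.
by rewrite -val_eqE /=; case: (ltngtP (j : nat) i); rewrite ?mulr1 ?mul1r.
Qed.

(** Generators common to [A] and [B] cancel on the left and contribute squares of signs on the
    right. *)
Lemma clsignDl A B C : clsign R (symdiff A B) C = clsign R A C * clsign R B C.
Proof.
rewrite !clsignE ![\prod_(i in _) _]big_mkcond -big_split /=.
apply: eq_bigr => i _; rewrite in_symdiff.
case: (i \in A) (i \in B) => [] []; rewrite ?mulr1 ?mul1r //= -big_split /=.
by rewrite big1 // => j _; rewrite /epair; case: ifP; rewrite ?mulrNN mulr1.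
Qed.

Lemma clsignDr A B C : clsign R A (symdiff B C) = clsign R A B * clsign R A C.
Proof.
rewrite !clsignE -big_split /=; apply: eq_bigr => i _.
rewrite ![\prod_(i in _) _]big_mkcond -big_split /=.
apply: eq_bigr => j _; rewrite in_symdiff.
case: (j \in B) (j \in C) => [] []; rewrite ?mulr1 ?mul1r //=.
by rewrite /epair; case: ifP; rewrite ?mulrNN mulr1.
Qed.

Lemma symdiff_bij A : bijective (symdiff A).
Proof. by exists (symdiff A) => B; rewrite symdiffK. Qed.

(** On blades, associativity is the cocycle identity of the sign, which follows from
    bimultiplicativity. *)
Lemma cl_mulA a b c : cl_mul a (cl_mul b c) = cl_mul (cl_mul a b) c.
Proof.
apply/funext => D; rewrite /cl_mul.
under [RHS]eq_bigr => A _ do rewrite 2!mulr_suml.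
rewrite exchange_big /=; apply: eq_bigr => E _.
rewrite mulr_sumr mulr_suml.
rewrite [RHS](reindex (symdiff E)) /=; last exact/onW_bij/symdiff_bij.
apply: eq_bigr => G _; rewrite symdiffK -symdiffA clsignDl.
have -> : symdiff E (symdiff G D) = symdiff G (symdiff E D).
  by rewrite symdiffA (symdiffC E) -symdiffA.
have -> : clsign R E (symdiff E D) = clsign R E G * clsign R E (symdiff G (symdiff E D)).
  by rewrite -clsignDr symdiffK.
ring.
Qed.

Lemma cl_mulDl a b c : cl_mul (a + b) c = cl_mul a c + cl_mul b c.
Proof.
apply/funext => D; rewrite /cl_mul /= -[RHS]big_split; apply: eq_bigr => A _.
by rewrite /= -!mulrDl.
Qed.

Lemma cl_mulZl r a b : cl_mul (cl_smul r a) b = cl_smul r (cl_mul a b).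
Proof.
apply/funext => D; rewrite /cl_smul /cl_mul mulr_sumr.
by apply: eq_bigr => A _; rewrite !mulrA.
Qed.

Lemma clsign0 A : clsign R finset.set0 A = 1.
Proof. by rewrite clsignE big_set0. Qed.

Lemma cl_mul_scal r a : cl_mul (cl_scal r) a = cl_smul r a.
Proof.
apply/funext => D; rewrite /cl_mul /cl_smul (bigD1 finset.set0) //= big1 ?addr0.
  by rewrite /cl_scal eqxx symdiff0 clsign0 mulr1.
by move=> A A0; rewrite /cl_scal (negbTE A0) !mul0r.
Qed.

Lemma ebasE i : @ebas R m i.+1 = fun C => if C == [set i] then 1 else 0.
Proof.
apply/funext => C; rewrite /ebas /=; congr (if _ == _ then _ else _).
by apply/setP => j; rewrite !inE.
Qed.

Lemma cl_mul_ebas i a D :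
  cl_mul (@ebas R m i.+1) a D = a (symdiff [set i] D) * clsign R [set i] (symdiff [set i] D).
Proof.
rewrite ebasE /cl_mul (bigD1 [set i]) //= eqxx mul1r big1 ?addr0 // => A /negbTE ->.
by rewrite !mul0r.
Qed.

Lemma ebas_sq i a : cl_mul (@ebas R m i.+1) (cl_mul (@ebas R m i.+1) a) = - a.
Proof.
apply/funext => D; rewrite !cl_mul_ebas.
rewrite symdiffK -mulrA -clsignDr.
rewrite (symdiffC [set i] D) symdiffK clsignE !big_set1 /epair leqnn.
by rewrite mulrN1.
Qed.

Lemma ebas_anticomm i j a : i != j ->
  cl_mul (@ebas R m i.+1) (cl_mul (@ebas R m j.+1) a) =
  - cl_mul (@ebas R m j.+1) (cl_mul (@ebas R m i.+1) a).
Proof.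
move=> ij; apply/funext => D.
rewrite -[RHS]/(- (cl_mul _ _ D)) !cl_mul_ebas !symdiffA (symdiffC [set j]).
rewrite -!mulrA -mulrN; congr (_ * _).
rewrite !clsignDr !clsignE !big_set1 /epair !leqnn.
by case: ltngtP ij => [||/val_inj ->]; rewrite ?eqxx //= => _ _; ring.
Qed.

End CliffordProduct.

(** * Symmetry of second derivatives and termwise differentiation *)

Section Differentiation.
Local Open Scope classical_set_scope.
Variables (R : realType) (U V : normedModType R).
Implicit Types (f : V -> R).

(** The two difference quotients are the same function of [h], so this chain rule involves only the
    directional derivative along [w]. *)
Lemma is_derive_affine f (g : U -> V) (x v : U) (w : V) :
  (forall h, g (h *: v + x) = h *: w + g x) -> derivable f (g x) w ->
  is_derive x v (f \o g) ('D_w f (g x)).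
Proof.
move=> gE df.
have E : (fun h : R => h^-1 *: (((f \o g) \o shift x) (h *: v) - (f \o g) x))
       = (fun h : R => h^-1 *: ((f \o shift (g x)) (h *: w) - f (g x))).
  by apply/funext => h /=; rewrite gE.
by apply: DeriveDef; rewrite /derivable /derive E.
Qed.
End Differentiation.

(** * Mean value theorem along a line and its consequences *)

Section MeanValue.
Local Open Scope classical_set_scope.
Variables (R : realType) (V : normedModType R).
Implicit Types (f : V -> R) (x u v : V).

Lemma is_derive_line f x v (t : R) : derivable f (x + t *: v) v ->
  is_derive t 1 (fun s : R => f (x + s *: v)) ('D_v f (x + t *: v)).
Proof.
move=> df; apply: (@is_derive_affine R R V f (fun s : R => x + s *: v)) => // h.
by rewrite -[h *: 1]/(h * 1) mulr1 scalerDl addrCA.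
Qed.

Lemma MVT_line f x v (h : R) : 0 < h ->
  (forall t, 0 <= t <= h -> derivable f (x + t *: v) v) ->
  exists2 t, 0 < t < h & f (x + h *: v) - f x = h * 'D_v f (x + t *: v).
Proof.
move=> h0 df.
have [||t ht E] := @MVT R (fun s : R => f (x + s *: v)) (fun t => 'D_v f (x + t *: v)) 0 h h0.
- move=> t; rewrite in_itv /= => /andP[t0 th]; apply: is_derive_line.
  by apply: df; rewrite !ltW.
- apply: derivable_within_continuous => t; rewrite in_itv /= => th.
  by have [] := is_derive_line (df _ th).
exists t; first by move: ht; rewrite in_itv.
by move: E; rewrite scale0r addr0 subr0 mulrC.
Qed.

(** The mean value theorem is applied along [u] to $y\mapsto f(y+hv)-f(y)$, then along [v] to $D_u
    f$. *)
Lemma second_difference f u v x (h : R) : 0 < h ->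
  (forall y, derivable f y u) -> (forall y, derivable ('D_u f) y v) ->
  exists s t, [/\ 0 < s < h, 0 < t < h &
   (f (x + h *: u + h *: v) - f (x + h *: u)) - (f (x + h *: v) - f x) =
     h * (h * 'D_v ('D_u f) (x + s *: u + t *: v))].
Proof.
move=> h0 du dvu.
pose g := (f \o shift (h *: v)) - f.
have dg y : is_derive y u g ('D_u f (y + h *: v) - 'D_u f y).
  apply: is_deriveB; last exact: derivableP.
  by apply: is_derive_affine => // s; rewrite addrA.
have [s sh Es] := @MVT_line g x u h h0 (fun t _ => @ex_derive _ _ _ _ _ _ _ (dg _)).
have [t th Et] := @MVT_line ('D_u f) (x + s *: u) v h h0 (fun t _ => dvu _).
exists s, t; split => //.
by rewrite -Et; move: Es; rewrite derive_val.
Qed.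

(** Both mixed derivatives, taken at points near [x], equal the same second difference divided by
    $h^2$; continuity at [x] then forces equality. *)
Lemma derive_comm f u v x :
  (forall y, derivable f y u) -> (forall y, derivable f y v) ->
  (forall y, derivable ('D_u f) y v) -> (forall y, derivable ('D_v f) y u) ->
  {for x, continuous ('D_v ('D_u f))} -> {for x, continuous ('D_u ('D_v f))} ->
  'D_v ('D_u f) x = 'D_u ('D_v f) x.
Proof.
move=> du dv dvu duv cvu cuv.
apply/eqP; rewrite -subr_eq0; apply/negPn/negP => ne0.
set a := 'D_v _ x in ne0 *; set b := 'D_u _ x in ne0 *.
pose e := `|a - b| / 2.
have e0 : 0 < e by rewrite divr_gt0 // normr_gt0.
have [r1 /= r10 H1] : exists2 r : R, 0 < r & forall y, `|x - y| < r -> `|a - 'D_v ('D_u f) y| < e.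
  by have /cvgrPdist_lt/(_ _ e0)/nbhs_normP[r r0 H] := cvu; exists r => // y /H.
have [r2 /= r20 H2] : exists2 r : R, 0 < r & forall y, `|x - y| < r -> `|b - 'D_u ('D_v f) y| < e.
  by have /cvgrPdist_lt/(_ _ e0)/nbhs_normP[r r0 H] := cuv; exists r => // y /H.
(* With this [M] and [h], all intermediate points lie within both radii; the summand 1 keeps [M]
   positive when $u=v=0$. *)
pose M := `|u| + `|v| + 1.
have M0 : 0 < M by rewrite ltr_wpDl // addr_ge0.
pose h := Num.min r1 r2 / M.
have h0 : 0 < h by rewrite divr_gt0 // lt_min r10.
have near s t : 0 < s < h -> 0 < t < h -> `|x - (x + s *: u + t *: v)| < Num.min r1 r2.
  move=> /andP[s0 sh] /andP[t0 th].
  rewrite -addrA opprD addNKr normrN.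
  apply: (@lt_le_trans _ _ (h * M)); last by rewrite divfK // gt_eqF.
  apply: (@le_lt_trans _ _ (h * (`|u| + `|v|))).
    rewrite (le_trans (ler_normD _ _)) // !normrZ !gtr0_norm // mulrDr.
    by rewrite lerD // ler_wpM2r // ltW.
  by rewrite ltr_pM2l // ltrDl.
have [s [t [sh th E1]]] := second_difference x h0 du dvu.
have [t' [s' [th' sh' E2]]] := second_difference x h0 dv duv.
have : 'D_v ('D_u f) (x + s *: u + t *: v) = 'D_u ('D_v f) (x + t' *: v + s' *: u).
  apply: (mulfI (lt0r_neq0 h0)); apply: (mulfI (lt0r_neq0 h0)).
  by rewrite -E1 -E2 (addrAC x); ring.
have := near _ _ sh th; rewrite lt_min => /andP[/H1 n1 _].
have := near _ _ sh' th'; rewrite lt_min addrAC => /andP[_ /H2 n2] E.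
have : `|a - b| < e + e.
  rewrite (le_lt_trans _ (ltrD n1 n2)) // [X in _ <= _ + X]distrC E.
  by rewrite (le_trans _ (ler_normD _ _)) // addrA subrK.
by rewrite -splitr ltxx.
Qed.

Lemma mean_value_bound f x v (h M : R) :
  (forall y, derivable f y v) ->
  (forall t, `|t| <= `|h| -> `|'D_v f (x + t *: v)| <= M) ->
  `|f (x + h *: v) - f x| <= `|h| * M.
Proof.
move=> df bM; have [h0|h0|->] := ltgtP h 0; last first.
- by rewrite scale0r addr0 subrr !normr0 mul0r.
- have [t /andP[t0 th] ->] := MVT_line h0 (fun t _ => df (x + t *: v)).
  by rewrite normrM ler_wpM2l // bM // !gtr0_norm // ltW.
(* For negative [h] the segment is traversed from its other end, with step [- h]. *)
have nh0 : 0 < - h by rewrite oppr_gt0.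
have [t /andP[t0 th] E] := MVT_line nh0 (fun t _ => df (x + h *: v + t *: v)).
move: E; rewrite -!addrA -!scalerDl subrr scale0r addr0 distrC => ->.
rewrite normrM normrN ler_wpM2l // bM // !ltr0_norm //; last by lra.
by rewrite lerN2 lerDl ltW.
Qed.

(** The quotient of [F] is compared with that of one fixed [S N]. Uniform convergence of the
    derivatives controls the quotient of [S N - F], uniformly in [h]. *)
Lemma derive_limit (S : nat -> V -> R) (F G : V -> R) x v (r : R) : 0 < r ->
  (forall N y, derivable (S N) y v) ->
  (forall y, S ^~ y @ \oo --> F y) ->
  (forall e, 0 < e -> exists N, forall k y, (N <= k)%N -> ball x r y ->
     `|'D_v (S k) y - G y| < e) ->
  is_derive x v F (G x).
Proof.
move=> r0 dS cS uS.
suff cF : (fun h => h^-1 *: ((F \o shift x) (h *: v) - F x)) @ 0^' --> G x.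
  by apply: DeriveDef; [apply: cvgP cF | exact: cvg_lim cF].
(* The three errors below are bounded by [e], [e] and [e + e]. *)
apply/cvgrPdist_lt => e0 e0_gt0; pose e := e0 / 5.
have e_gt0 : 0 < e by rewrite divr_gt0.
have [N HN] := uS e e_gt0.
have small : \forall h \near (0 : R)^', `|h| * (`|v| + 1) < r.
  apply: cvg_within; apply/nbhs_normP; exists (r / (`|v| + 1)) => /=.
    by rewrite divr_gt0 // ltr_wpDl.
  by move=> h; rewrite /= sub0r normrN ltr_pdivlMr // ltr_wpDl.
(* The mean value bound holds for [S N - S l] with a constant independent of [l]; then [l] tends to
   infinity. *)
have dist h : `|h| * (`|v| + 1) < r ->
    `|(S N (x + h *: v) - F (x + h *: v)) - (S N x - F x)| <= `|h| * (e + e).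
  move=> hr.
  have cl : (fun l => `|(S N (x + h *: v) - S l (x + h *: v)) - (S N x - S l x)|) @ \oo -->
      `|(S N (x + h *: v) - F (x + h *: v)) - (S N x - F x)|.
    by apply: cvg_norm; apply: cvgB; apply: cvgB; (exact: cvg_cst || exact: cS).
  rewrite -(cvg_lim _ cl) //; apply: limr_le; first exact: cvgP cl.
  exists N => // l /= Nl.
  have dB y : is_derive y v (S N - S l) ('D_v (S N) y - 'D_v (S l) y).
    by apply: is_deriveB; exact: derivableP.
  have -> : (S N (x + h *: v) - S l (x + h *: v)) - (S N x - S l x) =
    (S N - S l) (x + h *: v) - (S N - S l) x by [].
  apply: mean_value_bound => [y|t th]; first by have [] := dB y.
  have bt : ball x r (x + t *: v).
    rewrite -ball_normE /= opprD addNKr normrN normrZ (le_lt_trans _ hr) //.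
    by rewrite ler_pM // lerDl.
  have [_ ->] := dB (x + t *: v).
  have -> : 'D_v (S N) (x + t *: v) - 'D_v (S l) (x + t *: v) =
    ('D_v (S N) (x + t *: v) - G (x + t *: v)) -
    ('D_v (S l) (x + t *: v) - G (x + t *: v)) by ring.
  by rewrite (le_trans (ler_normB _ _)) // lerD // ltW // HN.
have := dS N x; rewrite /derivable => /cvg_ex[l cl].
have El : 'D_v (S N) x = l by exact: cvg_lim cl.
have /cvgrPdist_lt/(_ e e_gt0) quot := cl.
near=> h.
have h0 : h != 0 by near: h; exact: nbhs_dnbhs_neq.
have hr : `|h| * (`|v| + 1) < r by near: h.
have q1 : `|l - h^-1 * (S N (x + h *: v) - S N x)| < e.
  by rewrite (addrC x); near: h.
have q2 : `|l - G x| < e by rewrite -El HN //; exact: ballxx.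
have q3 : `|h^-1 * ((S N (x + h *: v) - F (x + h *: v)) - (S N x - F x))| <= e + e.
  rewrite normrM normfV mulrC ler_pdivrMr ?normr_gt0 // mulrC.
  exact: dist.
rewrite /= (addrC (h *: v)) /GRing.scale /=.
have -> : G x - h^-1 * (F (x + h *: v) - F x) =
   (l - h^-1 * (S N (x + h *: v) - S N x)) - (l - G x) +
   h^-1 * ((S N (x + h *: v) - F (x + h *: v)) - (S N x - F x)) by ring.
rewrite (le_lt_trans (ler_normD _ _)) //.
have := ler_normB (l - h^-1 * (S N (x + h *: v) - S N x)) (l - G x).
by move: q1 q2 q3; rewrite /e; lra.
Unshelve. all: by end_near.
Qed.
End MeanValue.

(** * Smooth functions *)

Section SmoothFunctions.
Local Open Scope classical_set_scope.
Variables (R : realType) (m : nat).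
Local Notation V := 'rV[R]_(m.+1).
Local Notation fn := (V -> cl R m).
Implicit Types (f g h : fn) (a : cl R m) (X : V) (C : {set 'I_m}) (i j : 'I_m.+1).

Lemma smooth_continuous f C : smooth f -> continuous (f ^~ C).
Proof. by move=> /(_ [::] C)[]. Qed.

Lemma smooth_derivable f C j X : smooth f -> derivable (f ^~ C) X (dvec R j).
Proof. by move=> /(_ [::] C)[] + _; apply. Qed.

Lemma iterpd_rcons ds j f : iterpd (rcons ds j) f = iterpd ds (pd j f).
Proof. by rewrite /iterpd foldr_rcons. Qed.

Lemma smooth_pd f j : smooth f -> smooth (pd j f).
Proof. by move=> sf ds C; rewrite -iterpd_rcons. Qed.

(** Replaces induction on lists of derivatives: it is enough to find a class of continuous,
    partially derivable functions that is stable under [pd]. *)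
Lemma smooth_coind (P : fn -> Prop) :
  (forall f, P f -> (forall C, continuous (f ^~ C)) /\
     (forall C j X, derivable (f ^~ C) X (dvec R j)) /\ forall j, P (pd j f)) ->
  forall f, P f -> smooth f.
Proof.
move=> HP f Pf ds; elim/last_ind: ds f Pf => [|ds j IHds] f Pf C.
  by have [cf [df _]] := HP f Pf; split=> //; exact: cf.
by rewrite iterpd_rcons; apply: IHds; have [_ [_]] := HP f Pf; apply.
Qed.

Lemma pdP f j X C : smooth f -> is_derive X (dvec R j) (f ^~ C) (pd j f X C).
Proof. by move=> sf; apply: derivableP; apply: smooth_derivable. Qed.

Lemma pd_eq f g j : (forall X C, is_derive X (dvec R j) (f ^~ C) (g X C)) -> pd j f = g.
Proof. by move=> H; apply/funext => X; apply/funext => C; rewrite /pd derive_val. Qed.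

Lemma pdD_is_derive f g j X C : smooth f -> smooth g ->
  is_derive X (dvec R j) ((f + g) ^~ C) ((pd j f + pd j g) X C).
Proof. by move=> sf sg; apply: is_deriveD; apply: pdP. Qed.

Lemma pdD f g j : smooth f -> smooth g -> pd j (f + g) = pd j f + pd j g.
Proof. by move=> sf sg; apply: pd_eq => X C; apply: pdD_is_derive. Qed.

Lemma smoothD f g : smooth f -> smooth g -> smooth (f + g).
Proof.
move=> sf sg.
apply: (@smooth_coind (fun u => exists f g, [/\ smooth f, smooth g & u = f + g])); last first.
  by exists f, g.
move=> _ [{}f [{}g [{}sf {}sg ->]]]; split; [|split] => [C|C j X|j].
- by move=> X; apply: continuousD; exact: smooth_continuous.
- by have [] := pdD_is_derive j X C sf sg.
- by exists (pd j f), (pd j g); rewrite pdD //; split=> //; exact: smooth_pd.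
Qed.

Definition emul (k : 'I_m) f : fn := fun X => cl_mul (@ebas R m k.+1) (f X).

(** A generator permutes the coordinates up to sign, so regularity passes to the product coordinate
    by coordinate. *)
Lemma emulE k f X C :
  emul k f X C = f X (symdiff [set k] C) * clsign R [set k] (symdiff [set k] C).
Proof. exact: cl_mul_ebas. Qed.

Lemma pd_emul_is_derive k f j X C : smooth f ->
  is_derive X (dvec R j) ((emul k f) ^~ C) (emul k (pd j f) X C).
Proof.
move=> sf; have -> : (emul k f) ^~ C =
    clsign R [set k] (symdiff [set k] C) *: (f ^~ (symdiff [set k] C)).
  by apply/funext => Y; rewrite emulE mulrC.
by rewrite emulE mulrC; apply: is_deriveZ; exact: pdP.
Qed.

Lemma pd_emul k f j : smooth f -> pd j (emul k f) = emul k (pd j f).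
Proof. by move=> sf; apply: pd_eq => X C; apply: pd_emul_is_derive. Qed.

Lemma smooth_emul k f : smooth f -> smooth (emul k f).
Proof.
move=> sf.
apply: (@smooth_coind (fun u => exists2 f, smooth f & u = emul k f)); last by exists f.
move=> _ [{}f {}sf ->]; split; [|split] => [C|C j X|j].
- have -> : (emul k f) ^~ C = fun Y => f Y (symdiff [set k] C) * clsign R [set k] (symdiff [set k] C).
    by apply/funext => Y; rewrite emulE.
  move=> X; apply: (@continuousM R V (f ^~ (symdiff [set k] C))
      (cst (clsign R [set k] (symdiff [set k] C)))); last exact: cst_continuous.
  exact: smooth_continuous.
- by have [] := pd_emul_is_derive k j X C sf.
- by exists (pd j f); rewrite ?pd_emul //; exact: smooth_pd.
Qed.

Definition xmul i f : fn := fun X C => X ord0 i * f X C.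

Lemma is_derive_coord i j X :
  is_derive X (dvec R j) (fun Y : V => Y ord0 i) (i == j)%:R.
Proof.
have := @is_derive_affine R V R id (fun Y : V => Y ord0 i) X (dvec R j) (i == j)%:R.
rewrite derive_id; apply; last exact: derivable_id.
by move=> t; rewrite !mxE eqxx.
Qed.

Lemma pd_xmul_is_derive i f j X C : smooth f ->
  is_derive X (dvec R j) ((xmul i f) ^~ C) ((xmul i (pd j f) + (i == j)%:R *: f) X C).
Proof.
move=> sf; have D := is_deriveM (is_derive_coord i j X) (pdP j X C sf).
apply: is_derive_eq D _.
by congr (_ + _); exact: mulrC.
Qed.

Lemma pd_xmul i f j : smooth f -> pd j (xmul i f) = xmul i (pd j f) + (i == j)%:R *: f.
Proof. by move=> sf; apply: pd_eq => X C; apply: pd_xmul_is_derive. Qed.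

Lemma pdZ_is_derive c f j X C : smooth f ->
  is_derive X (dvec R j) ((c *: f) ^~ C) ((c *: pd j f) X C).
Proof. by move=> sf; apply: is_deriveZ; exact: pdP. Qed.

Lemma pdZ c f j : smooth f -> pd j (c *: f) = c *: pd j f.
Proof. by move=> sf; apply: pd_eq => X C; apply: pdZ_is_derive. Qed.

Lemma smoothZ c f : smooth f -> smooth (c *: f).
Proof.
move=> sf.
apply: (@smooth_coind (fun u => exists2 f, smooth f & u = c *: f)); last by exists f.
move=> _ [{}f {}sf ->]; split; [|split] => [C|C j X|j].
- move=> X; apply: (@continuousM R V (cst c) (f ^~ C)); first exact: cst_continuous.
  exact: smooth_continuous.
- by have [] := pdZ_is_derive c j X C sf.
- by exists (pd j f); rewrite ?pdZ //; exact: smooth_pd.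
Qed.

Lemma smooth_xmul i f : smooth f -> smooth (xmul i f).
Proof.
move=> sf.
(* The class contains $x_i f+g$ because differentiating $x_i f$ leaves an extra multiple of $f$. *)
apply: (@smooth_coind (fun u => exists f g, [/\ smooth f, smooth g & u = xmul i f + g])).
  move=> _ [{}f [g [{}sf sg ->]]].
  have D j X C : is_derive X (dvec R j) ((xmul i f + g) ^~ C)
      (((xmul i (pd j f) + (i == j)%:R *: f) + pd j g) X C).
    by apply: is_deriveD; [exact: pd_xmul_is_derive | exact: pdP].
  split; [|split] => [C|C j X|j].
  - move=> X; apply: (@continuousD R R V ((xmul i f) ^~ C) (g ^~ C)); last first.
      exact: smooth_continuous.
    apply: (@continuousM R V (fun Y => Y ord0 i) (f ^~ C)); first exact: coord_continuous.
    exact: smooth_continuous.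
  - by have [] := D j X C.
  - exists (pd j f), ((i == j)%:R *: f + pd j g).
    split; [exact: smooth_pd | by apply: smoothD; [exact: smoothZ | exact: smooth_pd] |].
    by rewrite addrA; exact: pd_eq.
exists f, (0 *: f); split => //; first exact: smoothZ.
by rewrite scale0r addr0.
Qed.

Lemma smooth0 : smooth (0 : fn).
Proof.
apply: (@smooth_coind (fun u => u = 0)) => // _ ->.
have D j X C : is_derive X (dvec R j) ((0 : fn) ^~ C) ((0 : fn) X C) by exact: is_derive_cst.
split; [|split] => [C|C j X|j]; first exact: cst_continuous.
- by have [] := D j X C.
- by apply: pd_eq => X C; apply: D.
Qed.

Lemma pd_comm f i j : smooth f -> pd i (pd j f) = pd j (pd i f).
Proof.
move=> sf; apply/funext => X; apply/funext => C.
apply: (@derive_comm R V (f ^~ C) (dvec R j) (dvec R i) X) => [Y|Y|Y|Y||].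
- exact: smooth_derivable.
- exact: smooth_derivable.
- exact: (@smooth_derivable (pd j f) C i Y (smooth_pd j sf)).
- exact: (@smooth_derivable (pd i f) C j Y (smooth_pd i sf)).
- exact: (@smooth_continuous _ C (smooth_pd i (smooth_pd j sf))).
- exact: (@smooth_continuous _ C (smooth_pd j (smooth_pd i sf))).
Qed.

Definition smoothp : {pred fn} := fun f => `[< smooth f >].

Lemma smoothpP f : reflect (smooth f) (f \in smoothp).
Proof. exact: asboolP. Qed.

Lemma smooth_submod_closed : submod_closed smoothp.
Proof.
split; first by apply/smoothpP; exact: smooth0.
by move=> c f g /smoothpP sf /smoothpP sg; apply/smoothpP/smoothD => //; exact: smoothZ.
Qed.
HB.instance Definition _ := GRing.isSubmodClosed.Build R fn smoothp smooth_submod_closed.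

(** Bundling smooth functions into a module turns the differential operators into everywhere defined
    linear maps, as the formal part requires. *)
Record sfun := SFun { sfun_val :> fn; _ : sfun_val \in smoothp }.
HB.instance Definition _ := [isSub for sfun_val].
HB.instance Definition _ := [Choice of sfun by <:].
HB.instance Definition _ := [SubChoice_isSubLmodule of sfun by <:].

Lemma sfunP (f : sfun) : smooth f.
Proof. by apply/smoothpP; case: f. Qed.

Definition mk_sfun f (sf : smooth f) : sfun := SFun (introT (smoothpP f) sf).

End SmoothFunctions.

(** * First-order operators *)

Section Operators.
Local Open Scope classical_set_scope.
Variables (R : realType) (m : nat).
Local Notation V := 'rV[R]_(m.+1).
Local Notation fn := (V -> cl R m).
Local Notation S := (sfun R m).
Implicit Types (f g : S) (X : V) (C : {set 'I_m}) (i j : 'I_m.+1) (k : 'I_m).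

Definition yproj X : V := \row_i if (i < 2)%N then 0 else X ord0 i.

Lemma yproj_continuous : continuous yproj.
Proof.
move=> X; suff H : forall e : R, 0 < e -> \forall Y \near X, ball (yproj X) e (yproj Y).
  exact: (iffRL (@cvg_ballP R V V (nbhs X) _ yproj (yproj X)) H).
move=> e e0; apply/nbhs_ballP; exists e => //= Y [_ bXY]; split=> // i j.
by rewrite !mxE; case: ifP => _; [exact: ballxx | rewrite ord1; exact: bXY].
Qed.

(** Forces dependence on $\underline{y}$ alone, so that the rules for $z^k f$ can be stated for
    every smooth [f]. *)
Definition proj (u : fn) : fn := fun X => u (yproj X).

Lemma pd_proj_is_derive (u : fn) j X C : smooth u ->
  is_derive X (dvec R j) ((proj u) ^~ C) (((2 <= j)%N%:R *: proj (pd j u)) X C).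
Proof.
move=> su; have yD h : yproj (h *: dvec R j + X) =
    h *: ((2 <= j)%N%:R *: dvec R j) + yproj X.
  apply/rowP => i; rewrite !mxE eqxx /=; have [->|ij] := eqVneq i j.
    by case: (ltnP j 2) => _ /=; rewrite ?mul0r ?mulr0 ?add0r ?mul1r.
  by rewrite -[false%:R]/(0 : R) !mulr0 !add0r.
have df : derivable (u ^~ C) (yproj X) ((2 <= j)%N%:R *: dvec R j).
  case: (ltnP 1 j) => _ /=; first by rewrite scale1r; exact: smooth_derivable.
  by rewrite scale0r; exact: derivable0.
apply: is_derive_eq (is_derive_affine yD df) _.
case: (ltnP 1 j) => _ /=; first by rewrite !scale1r.
by rewrite !scale0r derive0.
Qed.

Lemma pd_proj (u : fn) j : smooth u -> pd j (proj u) = (2 <= j)%N%:R *: proj (pd j u).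
Proof. by move=> su; apply: pd_eq => X C; exact: pd_proj_is_derive. Qed.

Lemma smooth_proj (u : fn) : smooth u -> smooth (proj u).
Proof.
move=> su; rewrite -[proj u]scale1r.
(* The scalar [c] absorbs the factor 0 or 1 produced by each derivative. *)
apply: (@smooth_coind R m (fun w => exists c u, smooth u /\ w = c *: proj u)); last by exists 1, u.
move=> _ [c [{}u [{}su ->]]].
have D j X C : is_derive X (dvec R j) ((c *: proj u) ^~ C)
    ((c *: ((2 <= j)%N%:R *: proj (pd j u))) X C).
  by apply: is_deriveZ; exact: pd_proj_is_derive.
split; [|split] => [C|C j X|j].
- move=> X; apply: (@continuousM R V (cst c) ((proj u) ^~ C)); first exact: cst_continuous.
  apply: (@continuous_comp _ _ _ yproj (u ^~ C)); first exact: yproj_continuous.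
  exact: smooth_continuous.
- by have [] := D j X C.
- exists (c * (2 <= j)%N%:R), (pd j u); split; first exact: smooth_pd.
  by rewrite -scalerA; exact: pd_eq.
Qed.

Definition spd j f : S := mk_sfun (smooth_pd j (sfunP f)).
Definition semul k f : S := mk_sfun (smooth_emul k (sfunP f)).
Definition sxmul i f : S := mk_sfun (smooth_xmul i (sfunP f)).
Definition sproj f : S := mk_sfun (smooth_proj (sfunP f)).

Lemma spd_is_linear j : linear (spd j).
Proof.
move=> c f g; apply: val_inj.
rewrite -[LHS]/(pd j (c *: sfun_val f + sfun_val g)).
rewrite -[RHS]/(c *: pd j (sfun_val f) + pd j (sfun_val g)).
rewrite pdD ?pdZ //; [exact: sfunP|apply: smoothZ; exact: sfunP|exact: sfunP].
Qed.
HB.instance Definition _ j := GRing.isLinear.Build R S S _ (spd j) (spd_is_linear j).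

Lemma semul_is_linear k : linear (semul k).
Proof.
move=> c f g; apply: val_inj; apply/funext => X; apply/funext => C /=.
rewrite emulE -[RHS]/(c * emul k f X C + emul k g X C) !emulE.
by rewrite -[LHS]/((c * _ + _) * _) mulrDl mulrA.
Qed.
HB.instance Definition _ k := GRing.isLinear.Build R S S _ (semul k) (semul_is_linear k).

Lemma sxmul_is_linear i : linear (sxmul i).
Proof.
move=> c f g; apply: val_inj; apply/funext => X; apply/funext => C /=.
rewrite /xmul -[RHS]/(c * (_ * _) + _ * _).
by rewrite -[LHS]/(_ * (c * _ + _)) mulrDr mulrCA.
Qed.
HB.instance Definition _ i := GRing.isLinear.Build R S S _ (sxmul i) (sxmul_is_linear i).

Lemma sproj_is_linear : linear sproj.
Proof. by move=> c f g; apply: val_inj; apply/funext => X; apply/funext => C. Qed.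
HB.instance Definition _ := GRing.isLinear.Build R S S _ sproj sproj_is_linear.

Lemma spd_comm i j f : spd i (spd j f) = spd j (spd i f).
Proof. by apply: val_inj; apply: pd_comm; exact: sfunP. Qed.

Lemma spd_semul j k f : spd j (semul k f) = semul k (spd j f).
Proof. by apply: val_inj; apply: pd_emul; exact: sfunP. Qed.

Lemma spd_sxmul j i f : spd j (sxmul i f) = sxmul i (spd j f) + (i == j)%:R *: f.
Proof. by apply: val_inj; apply: pd_xmul; exact: sfunP. Qed.

Lemma spd_sproj j f : spd j (sproj f) = (2 <= j)%N%:R *: sproj (spd j f).
Proof. by apply: val_inj; apply: pd_proj; exact: sfunP. Qed.

Lemma semul_sxmul k i f : semul k (sxmul i f) = sxmul i (semul k f).
Proof.
apply: val_inj; apply/funext => X; apply/funext => C.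
by rewrite /= /xmul !emulE mulrA.
Qed.

Lemma semul_sproj k f : semul k (sproj f) = sproj (semul k f).
Proof. by apply: val_inj. Qed.

Lemma semul_sq k f : semul k (semul k f) = - f.
Proof. by apply: val_inj; apply/funext => X; exact: ebas_sq. Qed.

Lemma semul_anticomm k l f : k != l -> semul k (semul l f) = - semul l (semul k f).
Proof. by move=> kl; apply: val_inj; apply/funext => X; exact: ebas_anticomm. Qed.

(* Every first-order operator used here is [s d_0 + \sum_k t_k e_{k+1} d_{k+1}]. *)
Definition fop (s : R) (t : 'I_m -> R) f : S :=
  s *: spd ord0 f + \sum_k t k *: semul k (spd (lift ord0 k) f).

Lemma fop_is_linear s t : linear (fop s t).
Proof.
move=> c f g; rewrite /fop.
under eq_bigr => k _ do rewrite 2!linearP scalerDr scalerA mulrC -scalerA.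
rewrite linearP scalerDr scalerA mulrC -scalerA big_split /= -scaler_sumr.
by rewrite [c *: (_ + _)]scalerDr addrACA.
Qed.
HB.instance Definition _ s t := GRing.isLinear.Build R S S _ (fop s t) (fop_is_linear s t).

Lemma fopD s t s' t' f : fop (s + s') (fun k => t k + t' k) f = fop s t f + fop s' t' f.
Proof.
rewrite /fop scalerDl addrACA; congr (_ + _).
by rewrite -big_split; apply: eq_bigr => k _; rewrite scalerDl.
Qed.

Definition slap f : S := \sum_(k : 'I_m | (0 < k)%N) spd (lift ord0 k) (spd (lift ord0 k) f).

Definition sdy : S -> S := fop 0 (fun k : 'I_m => (0 < k)%N%:R).
HB.instance Definition _ := GRing.Linear.on sdy.

Lemma sdy_sq f : sdy (sdy f) = - slap f.
Proof.
pose b k := ((0 < k)%N)%:R : R.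
pose T k l := b k *: (b l *: semul k (semul l (spd (lift ord0 k) (spd (lift ord0 l) f)))).
have -> : sdy (sdy f) = \sum_k \sum_l T k l.
  rewrite /sdy /fop !scale0r !add0r; apply: eq_bigr => k _.
  rewrite 2!linear_sum scaler_sumr; apply: eq_bigr => l _.
  by rewrite 2!linearZ /= spd_semul.
(* The double sum is added to its transpose: off-diagonal terms cancel, since the generators
   anticommute and the derivatives commute, and each diagonal term appears twice. *)
apply: (@scalerI _ _ 2); first by rewrite pnatr_eq0.
rewrite scaler_nat mulr2n {1}exchange_big -big_split /= /slap scalerN scaler_sumr -sumrN [RHS]big_mkcond.
apply: eq_bigr => k _; rewrite -big_split (bigD1 k) //= big1 => [|l lk].
  rewrite addr0 /T semul_sq /b; case: ifP => _; last by rewrite !scale0r addr0.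
  by rewrite !scale1r scaler_nat mulr2n opprD.
rewrite /T semul_anticomm // (spd_comm (lift ord0 l)) !scalerN scalerA (scalerA (b k)).
by rewrite mulrC addNr.
Qed.

End Operators.

(** * Powers of the complex variable *)

Section ComplexPowers.
Variables (R : realType) (m : nat).
Local Notation S := (sfun R m.+1).
Implicit Types (f g : S) (k : nat) (eps del : R) (X : 'rV[R]_(m.+2)).
Local Notation i1 := (lift ord0 ord0 : 'I_m.+2).

(* For [del = 1] and [del = -1] this is twice the derivative with respect to
   the conjugate of [z], respectively [z]. *)
Definition czop del : S -> S := fop 1 (fun k : 'I_m.+1 => if k == ord0 then del else 0).
HB.instance Definition _ del := GRing.Linear.on (czop del).

Definition sdirac : S -> S := fop 1 (fun=> 1).
HB.instance Definition _ := GRing.Linear.on sdirac.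

Lemma czopE del f : czop del f = spd ord0 f + del *: semul ord0 (spd i1 f).
Proof.
rewrite /czop /fop scale1r big_ord_recl /= big1 ?addr0 // => k _.
by rewrite scale0r.
Qed.

Lemma sdiracE f : sdirac f = czop 1 f + sdy f.
Proof.
rewrite /sdirac /czop /sdy -fopD addr0; congr (fop _ _ f).
by apply/funext => k; case: (unliftP ord0 k) => [k' ->|->] /=; rewrite ?addr0 ?add0r.
Qed.

(** Left multiplication by $z$ for [eps = 1] and by $\overline{z}$ for [eps = -1]. *)
Definition zmul eps f : S := sxmul ord0 f + eps *: semul ord0 (sxmul i1 f).

Lemma zmul_is_linear eps : linear (zmul eps).
Proof.
move=> c f g; rewrite /zmul 3!linearP scalerDr scalerA mulrC -scalerA.
by rewrite [c *: (_ + _)]scalerDr addrACA.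
Qed.
HB.instance Definition _ eps := GRing.isLinear.Build R S S _ (zmul eps) (zmul_is_linear eps).

Lemma spd_zmul j eps f : spd j (zmul eps f) =
  zmul eps (spd j f) + ((ord0 == j)%:R *: f + (eps * (i1 == j)%:R) *: semul ord0 f).
Proof.
rewrite /zmul linearD linearZ /= spd_semul !spd_sxmul linearD linearZ /=.
by rewrite scalerDr scalerA addrACA.
Qed.

(** The generator $e_1$ commutes with $z$, while every other generator conjugates it. *)
Lemma semul_zmul (k : 'I_m.+1) eps f : semul k (zmul eps f) =
  zmul (if k == ord0 then eps else - eps) (semul k f).
Proof.
rewrite /zmul linearD linearZ /= -!semul_sxmul; congr (_ + _).
case: eqVneq => [->//|k0].
by rewrite semul_anticomm // scalerN scaleNr semul_sxmul.
Qed.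

(** The term [- del * eps] comes from $e_1^2=-1$. For signs $\pm1$ the factor is 0 when they agree
    and 2 when they differ. *)
Lemma czop_zmul del eps f :
  czop del (zmul eps f) = zmul eps (czop del f) + (1 - del * eps) *: f.
Proof.
have E (a b : S) : semul ord0 (zmul eps a + b) = zmul eps (semul ord0 a) + semul ord0 b.
  by rewrite (linearD (semul ord0)) /= semul_zmul eqxx.
have E' (a b : S) : zmul eps (a + del *: b) = zmul eps a + del *: zmul eps b.
  by rewrite addrC linearP addrC.
rewrite !czopE !spd_zmul E E' /= mulr0 mulr1 !scale0r scale1r addr0 add0r.
rewrite linearZ /= semul_sq scalerDr addrACA scalerN scalerN scalerA.
by rewrite scalerBl scale1r.
Qed.

Lemma sdy_zmul eps f : sdy (zmul eps f) = zmul (- eps) (sdy f).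
Proof.
rewrite /sdy /fop !scale0r !add0r linear_sum; apply: eq_bigr => k _.
rewrite linearZ /=; case: (unliftP ord0 k) => [k' ->|->] /=; last by rewrite !scale0r.
by rewrite spd_zmul !scale0r mulr0 scale0r !addr0 semul_zmul.
Qed.

Lemma czop_sproj del f : czop del (sproj f) = 0.
Proof. by rewrite czopE !spd_sproj /= !scale0r linear0 scaler0 addr0. Qed.

Lemma sdy_sproj f : sdy (sproj f) = sproj (sdy f).
Proof.
rewrite /sdy /fop !scale0r !add0r linear_sum; apply: eq_bigr => k _.
rewrite linearZ /=; case: (unliftP ord0 k) => [k' ->|->] /=; last by rewrite !scale0r.
by rewrite spd_sproj /= !scale1r semul_sproj.
Qed.

(** The maps $W_k$ and $\overline{W}_k$, for [eps = 1] and [eps = -1]; dividing by $k!$ removes the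
    factor $k$ from their derivatives. *)
Definition zpow eps k f : S := k`!%:R^-1 *: iter k (zmul eps) (sproj f).

Lemma zpow_is_linear eps k : linear (zpow eps k).
Proof.
move=> c f g; rewrite /zpow linearP iter_linearD iter_linearZ scalerDr.
by rewrite !scalerA mulrC.
Qed.
HB.instance Definition _ eps k :=
  GRing.isLinear.Build R S S _ (zpow eps k) (zpow_is_linear eps k).

Lemma czop_iter_zmul del eps k f : czop del (iter k.+1 (zmul eps) (sproj f)) =
  (k.+1%:R * (1 - del * eps)) *: iter k (zmul eps) (sproj f).
Proof.
elim: k => [|k IHk]; first by rewrite /= czop_zmul czop_sproj linear0 add0r mul1r.
rewrite iterS czop_zmul IHk linearZ -iterS -scalerDl.
by rewrite -[k.+2%:R]natr1 mulrDl mul1r.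
Qed.

Lemma czop_zpow0 del eps f : czop del (zpow eps 0 f) = 0.
Proof. by rewrite linearZ /= czop_sproj scaler0. Qed.

Lemma czop_zpowS del eps k f :
  czop del (zpow eps k.+1 f) = (1 - del * eps) *: zpow eps k f.
Proof.
rewrite linearZ /= czop_iter_zmul !scalerA; congr (_ *: _).
rewrite factS natrM; field.
by rewrite -(natrD _ 1) !pnatr_eq0 -lt0n fact_gt0.
Qed.

Lemma czop_zpow_eq0 del eps k f : del * eps = 1 -> czop del (zpow eps k f) = 0.
Proof.
by case: k => [|k] de; rewrite ?czop_zpow0 // czop_zpowS de subrr scale0r.
Qed.

Lemma sdy_zpow eps k f : sdy (zpow eps k f) = zpow (- eps) k (sdy f).
Proof.
rewrite linearZ /=; congr (_ *: _).
by elim: k => [|k IHk] /=; rewrite ?sdy_sproj // sdy_zmul IHk.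
Qed.

Lemma sdirac_zpow k f : sdirac (zpow 1 k f) = zpow (-1) k (sdy f).
Proof.
by rewrite sdiracE sdy_zpow czop_zpow_eq0 ?mulr1 // add0r.
Qed.

Lemma sdirac_zpowN0 f : sdirac (zpow (-1) 0 f) = zpow 1 0 (sdy f).
Proof. by rewrite sdiracE sdy_zpow czop_zpow0 add0r opprK. Qed.

Lemma sdirac_zpowNS k f :
  sdirac (zpow (-1) k.+1 f) = zpow (-1) k f *+ 2 + zpow 1 k.+1 (sdy f).
Proof.
by rewrite sdiracE sdy_zpow czop_zpowS opprK mul1r opprK -(mulr2n 1) scaler_nat.
Qed.

Definition zcl eps X : cl R m.+1 :=
  cl_add (cl_scal (xc X 0)) (cl_smul (eps * xc X 1) (@ebas R m.+1 1)).

Lemma zmul_val eps f X : zmul eps f X = cl_mul (zcl eps X) (f X).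
Proof.
rewrite -[zcl eps X]/(cl_scal (xc X 0) + cl_smul (eps * xc X 1) (@ebas R m.+1 1) : _ -> R).
rewrite cl_mulDl cl_mul_scal cl_mulZl; apply/funext => C.
rewrite -[LHS]/(X ord0 ord0 * f X C + eps * cl_mul (@ebas R m.+1 1) (xmul i1 f X) C).
have -> : i1 = inord 1 by apply: val_inj; rewrite /= inordK.
have -> : ord0 = inord 0 :> 'I_m.+2 by apply: val_inj; rewrite /= inordK.
congr (_ + _); rewrite /cl_smul -mulrA !(@cl_mul_ebas R m.+1 ord0) /xmul.
by rewrite -!mulrA.
Qed.

Lemma zpow_val eps k f X : iter k (zmul eps) (sproj f) X =
  cl_mul (cl_exp (zcl eps X) k) (f (yproj X)).
Proof.
elim: k => [|k IHk].
  by rewrite cl_mul_scal; apply/funext => C; rewrite /cl_smul mul1r.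
by rewrite iterS zmul_val IHk cl_mulA.
Qed.

End ComplexPowers.

(** * Limits of smooth functions *)

Section TermwiseLimits.
Local Open Scope classical_set_scope.
Variables (R : realType) (m : nat).
Local Notation V := 'rV[R]_(m.+1).
Local Notation fn := (V -> cl R m).
Local Notation S := (sfun R m).
Implicit Types (f : S) (u : nat -> S) (X : V) (C : {set 'I_m}) (s : R) (t : 'I_m -> R).

Lemma inord_lift0 (k : 'I_m) : inord k.+1 = lift ord0 k :> 'I_m.+1.
Proof. by apply: val_inj; rewrite /= inordK // ltnS. Qed.

Lemma sfun_sumE (I : Type) (r : seq I) (P : pred I) (F : I -> S) X C :
  (\sum_(i <- r | P i) F i : S) X C = \sum_(i <- r | P i) F i X C.
Proof. by elim/big_rec2: _ => // i x y _ <-. Qed.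

Lemma fop_val s t f X C : fop s t f X C = s * pd ord0 f X C +
  \sum_(k < m) t k * cl_mul (@ebas R m k.+1) (pd (lift ord0 k) f X) C.
Proof.
rewrite /fop -[LHS]/(s * pd ord0 f X C + sfun_val (\sum_k _) X C).
by rewrite sfun_sumE.
Qed.

Lemma dirac_opE (u : fn) X C : dirac_op u X C = pd ord0 u X C +
  \sum_(k < m) cl_mul (@ebas R m k.+1) (pd (lift ord0 k) u X) C.
Proof.
have i0 : inord 0 = ord0 :> 'I_m.+1 by apply: val_inj; rewrite /= inordK.
by rewrite /dirac_op i0; under eq_bigr do rewrite inord_lift0.
Qed.

Lemma sdy_val f : sdy f = dy f :> fn.
Proof.
apply/funext => X; apply/funext => C; rewrite /sdy fop_val mul0r add0r /dy.
rewrite [RHS]big_mkcond; apply: eq_bigr => k _; rewrite inord_lift0.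
by case: ifP => _; rewrite ?mul1r ?mul0r.
Qed.

Lemma slap_val f : slap f = lapy f :> fn.
Proof.
apply/funext => X; apply/funext => C; rewrite /slap sfun_sumE.
by apply: eq_bigr => k _; rewrite inord_lift0.
Qed.

Lemma iter_sdy_val p f : iter p (@sdy R m) f = iter p (@dy R m) f :> fn.
Proof. by elim: p => // p IHp; rewrite !iterS sdy_val IHp. Qed.

Lemma iter_slap_val p f : iter p (@slap R m) f = iter p (@lapy R m) f :> fn.
Proof. by elim: p => // p IHp; rewrite !iterS slap_val IHp. Qed.

(** Converts $\Delta^n A_k=0$ into $d^{2n}A_k=0$. *)
Lemma iter_sdy_double p f :
  iter p.*2 (@sdy R m) f = (-1) ^+ p *: iter p (@slap R m) f.
Proof.
elim: p => [|p IHp]; first by rewrite scale1r.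
by rewrite doubleS !iterS IHp !linearZ /= sdy_sq exprSr mulrN1 scaleNr scalerN.
Qed.

Definition siterpd (ds : seq 'I_m.+1) f : S := foldr (@spd R m) f ds.

Lemma siterpdD ds f g : siterpd ds (f + g) = siterpd ds f + siterpd ds g.
Proof. by elim: ds => //= d ds ->; rewrite linearD. Qed.

Lemma siterpd_val ds f : siterpd ds f = iterpd ds f :> fn.
Proof. by elim: ds => // d ds /= ->. Qed.

Lemma spd_fop j s t f : spd j (fop s t f) = fop s t (spd j f).
Proof.
rewrite /fop linearD linearZ linear_sum spd_comm; congr (_ + _).
by apply: eq_bigr => k _; rewrite linearZ /= spd_semul spd_comm.
Qed.

Lemma siterpd_fop ds s t f : siterpd ds (fop s t f) = fop s t (siterpd ds f).
Proof. by elim: ds => //= d ds ->; rewrite spd_fop. Qed.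

Lemma iterpd_fop ds s t f X C : iterpd ds (fop s t f) X C =
  s * iterpd (ord0 :: ds) f X C +
  \sum_(k < m) t k * (iterpd (lift ord0 k :: ds) f X (symdiff [set k]%SET C) *
                clsign R [set k]%SET (symdiff [set k]%SET C)).
Proof.
rewrite -siterpd_val siterpd_fop fop_val siterpd_val; congr (_ + _).
by apply: eq_bigr => k _; rewrite cl_mul_ebas.
Qed.

Lemma cvg_finsum (I : Type) (r : seq I) (F : I -> nat -> R) (l : I -> R) :
  (forall i, F i @ \oo --> l i) ->
  (fun n => \sum_(i <- r) F i n) @ \oo --> \sum_(i <- r) l i.
Proof.
move=> Fl; elim: r => [|i r IHr].
  by under eq_fun => n do rewrite big_nil; rewrite big_nil; exact: cvg_cst.
by under eq_fun => n do rewrite big_cons; rewrite big_cons; apply: cvgD.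
Qed.

Lemma loc_unif_cvgD (F G : nat -> V -> R) :
  loc_unif_cvg F -> loc_unif_cvg G -> loc_unif_cvg (fun N X => F N X + G N X).
Proof.
move=> uF uG X0; have [r1 r10 [g1 H1]] := uF X0; have [r2 r20 [g2 H2]] := uG X0.
exists (Num.min r1 r2); first by rewrite lt_min r10.
exists (fun X => g1 X + g2 X) => e e0.
have e20 : 0 < e / 2 by rewrite divr_gt0.
have [N1 K1] := H1 _ e20; have [N2 K2] := H2 _ e20.
exists (maxn N1 N2) => k Y; rewrite geq_max => /andP[k1 k2] bY.
rewrite opprD addrACA (le_lt_trans (ler_normD _ _)) // [e]splitr ltrD //.
  by apply: K1 => //; apply: le_ball bY; rewrite ge_min lexx.
by apply: K2 => //; apply: le_ball bY; rewrite ge_min lexx orbT.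
Qed.

Lemma loc_unif_cvgZ (c : R) (F : nat -> V -> R) :
  loc_unif_cvg F -> loc_unif_cvg (fun N X => c * F N X).
Proof.
move=> uF X0; have [r r0 [g H]] := uF X0.
exists r => //; exists (fun X => c * g X) => e e0.
have c0 : 0 < `|c| + 1 by rewrite ltr_wpDl.
have [N K] := H _ (divr_gt0 e0 c0).
exists N => k Y Nk bY; rewrite -mulrBr normrM.
apply: (@le_lt_trans _ _ ((`|c| + 1) * `|F k Y - g Y|)).
  by rewrite ler_wpM2r // lerDl.
by rewrite mulrC -ltr_pdivlMr // K.
Qed.

Lemma loc_unif_cvg_sum (I : Type) (r : seq I) (F : I -> nat -> V -> R) :
  (forall i, loc_unif_cvg (F i)) -> loc_unif_cvg (fun N X => \sum_(i <- r) F i N X).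
Proof.
move=> uF; elim: r => [|i r IHr] X0.
  exists 1 => //; exists (fun=> 0) => e e0; exists 0%N => k Y _ _.
  by rewrite big_nil subrr normr0.
have [e e0 [g H]] := loc_unif_cvgD (uF i) IHr X0.
exists e => //; exists g => d d0; have [N K] := H d d0.
by exists N => k Y; rewrite big_cons; exact: K.
Qed.

Lemma loc_unif_cvg_pointwise (F : nat -> V -> R) X (r : R) (g : V -> R) : 0 < r ->
  (forall e : R, 0 < e -> exists N : nat, forall k Y,
     (N <= k)%N -> ball X r Y -> `|F k Y - g Y| < e) ->
  F ^~ X @ \oo --> g X.
Proof.
move=> r0 H; apply/cvgrPdist_lt => e e0; have [N K] := H e e0.
by exists N => // k /= Nk; rewrite distrC; apply: K => //; exact: ballxx.
Qed.

Definition unif_smooth_cvg r u := forall ds C, (size ds <= r)%N ->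
  loc_unif_cvg (fun N X => iterpd ds (u N) X C).

Lemma unif_smooth_cvg_fop r s t u :
  unif_smooth_cvg r.+1 u -> unif_smooth_cvg r (fun N => fop s t (u N)).
Proof.
move=> uu ds C dsr.
rewrite (_ : (fun _ => _) = fun N X => s * iterpd (ord0 :: ds) (u N) X C +
  \sum_(k < m) t k * (clsign R [set k]%SET (symdiff [set k]%SET C) *
    iterpd (lift ord0 k :: ds) (u N) X (symdiff [set k]%SET C))); last first.
  apply/funext => N; apply/funext => X; rewrite iterpd_fop; congr (_ + _).
  by apply: eq_bigr => k _; rewrite [in RHS](mulrC (clsign _ _ _)).
apply: loc_unif_cvgD; first by apply: loc_unif_cvgZ; exact: (uu (ord0 :: ds)).
apply: loc_unif_cvg_sum => k; apply/loc_unif_cvgZ/loc_unif_cvgZ.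
exact: (uu (lift ord0 k :: ds)).
Qed.

(** Locally uniform convergence of first derivatives allows termwise differentiation. [F] is a plain
    function here, since the limit is not known to be smooth. *)
Lemma cvg_dirac_op u (F : fn) : unif_smooth_cvg 1 u ->
  (forall X C, (fun N => u N X C) @ \oo --> F X C) ->
  forall X C, (fun N => fop 1 (fun=> 1) (u N) X C) @ \oo --> dirac_op F X C.
Proof.
move=> uu uF X C.
have cpd j D : (fun N => pd j (u N) X D) @ \oo --> pd j F X D.
  have [r r0 [g H]] := uu [:: j] D isT X.
  have -> : pd j F X D = g X.
    have du N Y : derivable (fun Y => u N Y D) Y (dvec R j).
      by apply: smooth_derivable; exact: sfunP.
    have dF := @derive_limit R V _ (F ^~ D) g X (dvec R j) r r0 du (fun Y => uF Y D) H.
    by rewrite /pd derive_val.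
  exact: loc_unif_cvg_pointwise r0 H.
rewrite dirac_opE.
rewrite (_ : (fun _ => _) = fun N => pd ord0 (u N) X C + \sum_(k : 'I_m)
   pd (lift ord0 k) (u N) X (symdiff [set k]%SET C) *
     clsign R [set k]%SET (symdiff [set k]%SET C)); last first.
  apply/funext => N; rewrite fop_val mul1r; congr (_ + _).
  by apply: eq_bigr => k _; rewrite mul1r cl_mul_ebas.
apply: cvgD; first exact: cpd.
apply: cvg_finsum => k; rewrite cl_mul_ebas.
by apply: cvgM; [exact: cpd | exact: cvg_cst].
Qed.

(** Each application of the operator consumes one order of locally uniform convergence. *)
Lemma cvg_iter_dirac_op n u (F : fn) : unif_smooth_cvg n u ->
  (forall X C, (fun N => u N X C) @ \oo --> F X C) ->
  forall X C, (fun N => iter n (fop 1 (fun=> 1)) (u N) X C) @ \oo -->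
    iter n (@dirac_op R m) F X C.
Proof.
elim: n u F => [|n IHn] u F uu uF X C; first exact: uF.
under eq_fun => N do rewrite iterSr.
rewrite iterSr; apply: IHn; first exact: unif_smooth_cvg_fop.
by apply: cvg_dirac_op => // ds D ds1; apply: uu; exact: leq_trans ds1 _.
Qed.

Definition null u := forall X C, (fun k => u k X C) @ \oo --> (0 : R).

Lemma null0 : null (fun=> 0).
Proof. by move=> X C; exact: cvg_cst. Qed.

Lemma nullP c u v : null u -> null v -> null (fun k => c *: u k + v k).
Proof.
move=> nu nv X C.
have E k : (c *: u k + v k : S) X C = c * u k X C + v k X C by [].
under eq_fun => k do rewrite E.
have := cvgD (cvgM (cvg_cst c) (nu X C)) (nv X C).
by rewrite mulr0 addr0; apply.
Qed.

Lemma null_shift u : null (fun k => u k.+1) <-> null u.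
Proof. by split=> nu X C; have := nu X C; rewrite (cvg_shiftS (fun k => u k X C)). Qed.

Definition smooth_null r u := forall ds, (size ds <= r)%N -> null (fun k => siterpd ds (u k)).

Lemma smooth_null_fop r s t u :
  smooth_null r.+1 u -> smooth_null r (fun k => fop s t (u k)).
Proof.
move=> nu ds dsr X C.
under eq_fun => k do rewrite siterpd_val iterpd_fop.
have nu0 d D : (size (d :: ds) <= r.+1)%N ->
    (fun k => iterpd (d :: ds) (u k) X D) @ \oo --> (0 : R).
  by move=> /nu/(_ X D); under eq_fun => k do rewrite siterpd_val.
have sum0 : \sum_(l < m) t l * (0 * clsign R [set l]%SET (symdiff [set l]%SET C)) = 0 :> R.
  by apply: big1 => l _; rewrite mul0r mulr0.
have Hs : (fun k => \sum_(l < m) t l * (iterpd (lift ord0 l :: ds) (u k) X (symdiff [set l]%SET C) *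
    clsign R [set l]%SET (symdiff [set l]%SET C))) @ \oo --> (0 : R).
  rewrite -{2}sum0; apply: cvg_finsum => l; apply: cvgM; first exact: cvg_cst.
  by apply: cvgM; [exact: nu0 | exact: cvg_cst].
by have := cvgD (cvgM (cvg_cst s) (nu0 ord0 C dsr)) Hs; rewrite mulr0 add0r; apply.
Qed.

Lemma smooth_null_iter r p s t u :
  smooth_null (p + r) u -> smooth_null r (fun k => iter p (fop s t) (u k)).
Proof.
elim: p r => // p IHp r nu; apply: smooth_null_fop; apply: IHp.
by rewrite addnS.
Qed.

End TermwiseLimits.

(** * The series *)

Section Assembly.
Local Open Scope classical_set_scope.
Variables (R : realType) (m n : nat) (c : nat -> R).
Local Notation S := (sfun R m.+1).
Local Notation fn := ('rV[R]_(m.+2) -> cl R m.+1).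
Variables (A B : nat -> S).

(** The factor $k!$ compensates the division in [zpow]. *)
Definition scaledA k : S := k`!%:R *: A k.
(* [B 0] is arbitrary and does not occur in the series. *)
Definition scaledB k : S := if k is 0%N then 0 else k`!%:R *: B k.

Lemma depends_yproj (f : fn) X : depends_only_on_y f -> f (yproj X) = f X.
Proof.
move=> fy; apply/funext => C; apply: fy => j j2.
by rewrite mxE ltnNge j2.
Qed.

Lemma zpow_fact eps k (f : S) : zpow eps k (k`!%:R *: f) = iter k (zmul eps) (sproj f).
Proof.
have k0 : k`!%:R != 0 :> R by rewrite pnatr_eq0 -lt0n fact_gt0.
by rewrite /zpow linearZ iter_linearZ scalerA mulVf // scale1r.
Qed.

Hypothesis Ay : forall k, depends_only_on_y (A k).
Hypothesis By : forall k, (0 < k)%N -> depends_only_on_y (B k).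

Local Notation W k := (zpow 1 k : {linear S -> S}).
Local Notation Wb k := (zpow (-1) k : {linear S -> S}).
Local Notation Ak := (fun k => A k : fn).
Local Notation Bk := (fun k => B k : fn).

Lemma zcl1 (X : 'rV[R]_m.+2) : zcl 1 X = zc X.
Proof. by rewrite /zcl mul1r. Qed.

Lemma zclN1 (X : 'rV[R]_m.+2) : zcl (-1) X = zbc X.
Proof. by rewrite /zcl mulN1r. Qed.

Lemma sterm_val k : (0 < k)%N ->
  W k (scaledA k) + Wb k (scaledB k) = sterm Ak Bk k :> fn.
Proof.
case: k => // k _.
rewrite -[LHS]/(sfun_val (zpow 1 k.+1 (k.+1`!%:R *: A k.+1) +
  zpow (-1) k.+1 (k.+1`!%:R *: B k.+1))) !zpow_fact; apply/funext => X.
rewrite -[LHS]/(iter k.+1 (zmul 1) (sproj (A k.+1)) X + iter k.+1 (zmul (-1)) (sproj (B k.+1)) X).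
by rewrite !zpow_val zcl1 zclN1 !depends_yproj //; exact: By.
Qed.

Lemma psum_val N : fpsum (fun k => W k) (fun k => Wb k) (scaledA, scaledB) N = psum Ak Bk N :> fn.
Proof.
apply/funext => X; apply/funext => C.
rewrite /fpsum /psum sfun_sumE big_ord_recl big_add1 /= big_mkord; congr (_ + _).
  rewrite -[LHS]/(sfun_val (zpow 1 0 (0`!%:R *: A 0%N) + zpow (-1) 0 0) X C).
  rewrite linear0 addr0 zpow_fact.
  by rewrite -[LHS]/(A 0%N (yproj X) C) depends_yproj.
by apply: eq_bigr => k _; rewrite -(@sterm_val k.+1).
Qed.

Lemma iter_sdy_scaledA k : (forall X C, iter n (@lapy R m.+1) (A k) X C = 0) ->
  iter n.*2 (@sdy R m.+1) (scaledA k) = 0.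
Proof.
move=> h; rewrite iter_linearZ iter_sdy_double (_ : iter n _ (A k) = 0) ?scaler0 //.
by apply: val_inj; rewrite /= iter_slap_val; apply/funext => X; apply/funext => C; exact: h.
Qed.

Hypothesis BE : forall k, (1 <= k)%N -> forall X C,
     B k X C =
       \sum_(1 <= j < (minn n (k.+1)./2).+1)
         c j / ((2 * j).-1`!%:R * 'C(k, k - (2 * j).-1)%:R)
           * iter (2 * j).-1 (@dy R m.+1) (A (k - (2 * j).-1)%N) X C.

Lemma scaledBE k :
  scaledB k = \sum_(j < n) c j.+1 *: dshift (@sdy R m.+1) scaledA j.*2.+1 k.
Proof.
case: k => [|k]; first by rewrite big1 // => j _; rewrite scaler0.
apply: val_inj; apply/funext => X; apply/funext => C.
rewrite [RHS]sfun_sumE -[LHS]/((k.+1)`!%:R * B k.+1 X C) BE //.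
have index j : (2 * j.+1).-1 = j.*2.+1 by lia.
rewrite big_add1; under eq_bigr => j _ do rewrite index.
rewrite /= (@big_nat_widen _ _ _ 0 _ n) ?geq_minl // big_mkord mulr_sumr.
rewrite big_mkcond; apply: eq_bigr => j _.
(* After the shift from $j$ to $j+1$, the bound $\min(n,\lfloor (k+1)/2\rfloor)$ becomes the guard
   of [dshift]. *)
rewrite [X in if X then _ else _](_ : _ = (j.*2.+1 <= k.+1)%N); last first.
  by rewrite leq_min ltn_ord /=; lia.
rewrite -[RHS]/(c j.+1 * sfun_val (dshift _ _ _ _) X C) /dshift.
case: leqP => jk; first by rewrite [RHS]mulr0.
rewrite iter_linearZ -[sfun_val _ _ _]/(_`!%:R * sfun_val (iter _ _ _) X C).
rewrite iter_sdy_val mulrA [RHS]mulrA; congr (_ * _).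
(* With $p=2j+1$ and [k.+1] as upper index, $(k+1)!/(p!\binom{k+1}{k+1-p}) = (k+1-p)!$, the scaling
   of the [A] on the right. *)
have /(congr1 (fun x => x%:R : R)) := bin_fact (leq_subr j.*2.+1 k.+1).
have F0 : (j.*2.+1)`!%:R != 0 :> R by rewrite pnatr_eq0 -lt0n fact_gt0.
have G0 : 'C(k.+1, k.+1 - j.*2.+1)%:R != 0 :> R by rewrite pnatr_eq0 -lt0n bin_gt0 leq_subr.
rewrite subKn // natrM (natrM _ _ (j.*2.+1)`!) => <-; rewrite mulrCA; congr (_ * _).
by rewrite [X in _ / X]mulrC mulrCA mulfK // mulf_neq0.
Qed.

End Assembly.

(** * Passage to the limit for the series *)

Section MainTheorem.
Local Open Scope classical_set_scope.
Variables (R : realType) (m n : nat) (c : nat -> R).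
Local Notation fn := ('rV[R]_(m.+2) -> cl R m.+1).
Variables (Af Bf : nat -> fn).
Hypothesis c1 : c 1%N = - (1 / 2).
Hypothesis cS : forall j, (2 <= j)%N -> c j = - (1 / 2 ^+ j) *
  \sum_(1 <= l < (j./2).+1) \sum_(1 <= i < l.+1)
     ('C(j.+1, (2 * l).+1)%:R * 'C(l, i)%:R * c (j - i)%N).
Hypothesis sA : forall k, smooth (Af k).
Hypothesis sB : forall k, (1 <= k)%N -> smooth (Bf k).
Hypothesis yA : forall k, depends_only_on_y (Af k).
Hypothesis yB : forall k, (1 <= k)%N -> depends_only_on_y (Bf k).
Hypothesis ucvg : forall (ds : seq 'I_m.+2) C, (size ds <= n)%N ->
  loc_unif_cvg (fun N X => iterpd ds (psum Af Bf N) X C).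
Hypothesis harmA : forall k X C, iter n (@lapy R m.+1) (Af k) X C = 0.
Hypothesis BfE : forall k, (1 <= k)%N -> forall X C, Bf k X C =
  \sum_(1 <= j < (minn n (k.+1)./2).+1)
    c j / ((2 * j).-1`!%:R * 'C(k, k - (2 * j).-1)%:R)
      * iter (2 * j).-1 (@dy R m.+1) (Af (k - (2 * j).-1)%N) X C.

Lemma iter_dirac_op_Fser X C : iter n (@dirac_op R m.+1) (Fser Af Bf) X C = 0.
Proof.
pose A k := mk_sfun (sA k).
(* Smoothness of [Bf] is available from index 1 on, so index 0 gets the value 0. *)
pose B k : sfun R m.+1 := if k is k'.+1 then mk_sfun (sB (isT : (1 <= k'.+1)%N)) else 0.
have BE k : (0 < k)%N -> B k = Bf k :> fn by case: k.
have yB' k : (0 < k)%N -> depends_only_on_y (B k) by move=> k0; rewrite BE //; exact: yB.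
pose term k : sfun R m.+1 := zpow 1 k (scaledA A k) + zpow (-1) k (scaledB B k).
pose P : nat -> sfun R m.+1 := fpsum (fun k => zpow 1 k) (fun k => zpow (-1) k) (scaledA A, scaledB B).
have PE N : P N = psum Af Bf N :> fn.
  rewrite psum_val //; apply/funext => Y; apply/funext => D; rewrite /psum; congr (_ + _).
  by apply: eq_big_nat => k /andP[k0 _]; rewrite /sterm BE.
have PS N : P N.+1 = P N + term N.+1 by rewrite /P /fpsum big_ord_recr.
have uP : unif_smooth_cvg n P.
  by move=> ds D dsn; under eq_fun => N do rewrite PE; exact: ucvg.
have cF Y D : (fun N => P N Y D) @ \oo --> Fser Af Bf Y D.
  rewrite /Fser; under eq_fun => N do rewrite PE.
  have [r r0 [g H]] := @ucvg [::] D isT Y.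
  have cg := loc_unif_cvg_pointwise r0 H.
  by rewrite (cvg_lim _ cg).
(* A term is a difference of consecutive partial sums, so its derivatives up to order [n] tend to
   0. *)
have nterm : smooth_null n term.
  move=> ds dsn; apply/null_shift => Y D.
  have [r r0 [g H]] := uP ds D dsn Y.
  have cg := loc_unif_cvg_pointwise r0 H.
  have E k : siterpd ds (term k.+1) Y D = iterpd ds (P k.+1) Y D - iterpd ds (P k) Y D.
    rewrite PS -!siterpd_val siterpdD.
    by rewrite -[X in _ = X - _]/(siterpd ds (P k) Y D + siterpd ds (term k.+1) Y D) addrC addKr.
  under eq_fun => k do rewrite E.
  rewrite -(subrr (g Y)); apply: cvgB => //.
  by rewrite (cvg_shiftS (fun k => iterpd ds (P k) Y D)).
(* The formal result is applied with [czop (-1)] $=2\partial_z$ and [czop 1]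
   $=2\partial_{\overline{z}}$. *)
have lim0 : null (fun N => iter n (@sdirac R m) (P N)).
  apply: (@null_iterD R (sfun R m.+1) (@sdy R m.+1) (@sdirac R m) (czop (-1)) (czop 1)
    (fun k => zpow 1 k) (fun k => zpow (-1) k)
    (@sdirac_zpow R m) (@sdirac_zpowN0 R m) (@sdirac_zpowNS R m) _ (@null0 R _)
    (@nullP R _) (@null_shift R _) n _ _ _ _ c (scaledA A) (scaledB B) c1 cS).
  - by move=> k f /=; rewrite czop_zpowS mulr1 opprK -(mulr2n 1) scaler_nat.
  - by move=> k f /=; rewrite czop_zpow_eq0 // mulrNN mulr1.
  - by move=> k f /=; rewrite czop_zpowS mul1r opprK -(mulr2n 1) scaler_nat.
  - by move=> k f /=; rewrite czop_zpow_eq0 // mulr1.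
  - by move=> k; apply: iter_sdy_scaledA; exact: harmA.
  - by apply: scaledBE => k k0 Y D; rewrite BE //; exact: BfE.
  move=> t i tin; have H del : null (fun k => iter t (@sdirac R m) (iter i (@czop R m del) (term k))).
    have nt : smooth_null (i + (t + 0)) term by rewrite addn0 addnC tin.
    exact: (smooth_null_iter _ _ (smooth_null_iter _ _ nt) (ds := [::])).
  by split; exact: H.
(* The same sequence tends to $\partial_X^n F$ by termwise differentiation and to 0 by [lim0]. *)
have L := @cvg_iter_dirac_op R m.+1 n P _ uP cF X C.
exact: cvg_unique L (lim0 X C).
Qed.

End MainTheorem.

Theorem theorem6 (R : realType) (m : nat) (hm : (2 <= m)%N) (n : nat) (hn : (1 <= n)%N)
  (c : nat -> R)
  (hc1 : c 1%N = - (1 / 2))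
  (hcj : forall j : nat, (2 <= j)%N ->
     c j = - (1 / 2 ^+ j) *
       \sum_(1 <= l < (j./2).+1) \sum_(1 <= i < l.+1)
          ('C(j.+1, (2 * l).+1)%:R * 'C(l, i)%:R * c (j - i)%N))
  (Af Bf : nat -> 'rV[R]_(m.+1) -> cl R m)
  (hAsmooth : forall k, smooth (Af k))
  (hBsmooth : forall k, (1 <= k)%N -> smooth (Bf k))
  (hAy : forall k, depends_only_on_y (Af k))
  (hBy : forall k, (1 <= k)%N -> depends_only_on_y (Bf k))
  (hcvg : forall (ds : seq 'I_m.+1) (C : {set 'I_m}), (size ds <= n)%N ->
     loc_unif_cvg (fun N X => iterpd ds (psum Af Bf N) X C))
  (hharm : forall k X C, iter n (@lapy R m) (Af k) X C = 0)
  (hB : forall k, (1 <= k)%N -> forall X C,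
     Bf k X C =
       \sum_(1 <= j < (minn n (k.+1)./2).+1)
         c j / ((2 * j).-1`!%:R * 'C(k, k - (2 * j).-1)%:R)
           * iter (2 * j).-1 (@dy R m) (Af (k - (2 * j).-1)%N) X C) :
  forall (X : 'rV[R]_(m.+1)) (C : {set 'I_m}), iter n (@dirac_op R m) (Fser Af Bf) X C = 0.
Proof.
move: hm Af Bf hAsmooth hBsmooth hAy hBy hcvg hharm hB.
(* Writing the dimension as a successor gives $e_1$ the index [ord0]. *)
case: m => // m' _ Af Bf sA sB yA yB ucvg harmA BfE X C.
exact: iter_dirac_op_Fser hc1 hcj sA sB yA yB ucvg harmA BfE X C.
Qed.
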